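(* Consider the plant network, for $i\in\mathcal N$, $$\dot{\mathbf{x}}_i(t)=\mathbf{A}_i(t)\mathbf{x}_i(t)+\mathbf{B}_i(t)\mathbf{u}_i(t)+\sum_{j\in\mathcal N_i}\mathbf{H}_{ij}(t)\mathbf{x}_j(t),\qquad \mathbf{y}_i(t)=\mathbf{C}_i(t)\mathbf{x}_i(t),$$ with the distributed observer-based controller $$\dot{\hat{\mathbf{x}}}_i=\mathbf{A}_i\hat{\mathbf{x}}_i+\mathbf{B}_i\mathbf{u}_i+\sum_{j\in\mathcal N_i}\mathbf{H}_{ij}\hat{\mathbf{x}}_j+\mathbf{M}_i(\mathbf{C}_i\hat{\mathbf{x}}_i-\mathbf{y}_i)+\sum_{j\in\mathcal N_i}\mathbf{O}_{ij}(\mathbf{C}_j\hat{\mathbf{x}}_j-\mathbf{y}_j),\qquad \mathbf{u}_i=\mathbf{K}_i\hat{\mathbf{x}}_i+\sum_{j\in\mathcal N_i}\mathbf{L}_{ij}\hat{\mathbf{x}}_j$$ (all quantities evaluated at time $t$). Let $\beta_i>0$, $\epsilon_i>0$, $\gamma>0$ be constants, $\boldsymbol\beta=\mathrm{diag}(\beta_i\mathbf{1}^{n_i\times n_i})$, $\boldsymbol\epsilon=\mathrm{diag}(\epsilon_i\mathbf{I}_{n_i})$. Suppose that, recursively for $k=0,1,2,\dots$, starting with $t_0=0$, there are symmetric block-diagonal matrices $\mathbf{Z}_k=\mathrm{diag}(\mathbf{Z}_{k,i})$, $\hat{\mathbf{P}}_k=\mathrm{diag}(\hat{\mathbf{P}}_{k,i})$,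 block-diagonal matrices $\mathbf{W}_k=\mathrm{diag}(\mathbf{W}_{k,i})$, $\hat{\mathbf{W}}_k=\mathrm{diag}(\hat{\mathbf{W}}_{k,i})$, and $\mathbf{Y}_k=[\mathbf{Y}_{k,ij}]$, $\hat{\mathbf{Y}}_k=[\hat{\mathbf{Y}}_{k,ij}]$ with $\mathbf{Y}_{k,ii}=\mathbf{0}$, $\hat{\mathbf{Y}}_{k,ii}=\mathbf{0}$, satisfying the following convex constraints. Put $\mathbf{A}_k=\mathbf{A}(t_k)$, $\mathbf{B}_k=\mathbf{B}(t_k)$, $\mathbf{C}_k=\mathbf{C}(t_k)$, $\mathbf{H}_k=\mathbf{H}(t_k)$, $$\mathbf{F}_k=(\mathbf{A}_k+\mathbf{H}_k)\mathbf{Z}_k+\mathbf{B}_k(\mathbf{W}_k+\mathbf{Y}_k)+\boldsymbol\beta\circ\mathbf{Z}_k,$$ $$\hat{\mathbf{F}}_k=\hat{\mathbf{P}}_k(\mathbf{A}_k+\mathbf{H}_k)+(\hat{\mathbf{W}}_k+\hat{\mathbf{Y}}_k)\mathbf{C}_k+\boldsymbol\beta\circ\hat{\mathbf{P}}_k .$$ For all $k\ge0$ and all $i,j\in\mathcal N$: $$\mathbf{F}_k+\mathbf{F}_k^T+\gamma\mathbf{I}_n\preceq\mathbf{0},\qquad \hat{\mathbf{F}}_k+\hat{\mathbf{F}}_k^T+\gamma\mathbf{I}_n\preceq\mathbf{0},\qquad \boldsymbol\epsilon^{-1}\succeq\mathbf{Z}_k\succ\mathbf{0},\qquad \hat{\mathbf{P}}_k-\boldsymbol\epsilon\succeq\mathbf{0},$$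 $$\kappa_i\lambda_{\min}(\mathbf{Z}_{k,i})-\sigma_{\max}(\mathbf{W}_{k,i})\ge0,\qquad \iota_{ij}\lambda_{\min}(\mathbf{Z}_{k,j})-\sigma_{\max}(\mathbf{Y}_{k,ij})\ge0,$$ $$\mu_i\lambda_{\min}(\hat{\mathbf{P}}_{k,i})-\sigma_{\max}(\hat{\mathbf{W}}_{k,i})\ge0,\qquad \omega_{ij}\lambda_{\min}(\hat{\mathbf{P}}_{k,i})-\sigma_{\max}(\hat{\mathbf{Y}}_{k,ij})\ge0,$$ and for all $k\ge1$: $$\mathbf{Z}_k-\mathbf{Z}_{k-1}\succeq\mathbf{0},\qquad \hat{\mathbf{P}}_{k-1}-\hat{\mathbf{P}}_k\succeq\mathbf{0}.$$ For $t\in[t_k,t_{k+1})$ let the controller and observer gains be constant, equal to $$\mathbf{K}_{k,i}=\mathbf{W}_{k,i}\mathbf{Z}_{k,i}^{-1},\quad \mathbf{L}_{k,ij}=\mathbf{Y}_{k,ij}\mathbf{Z}_{k,j}^{-1},\quad \mathbf{M}_{k,i}=\hat{\mathbf{P}}_{k,i}^{-1}\hat{\mathbf{W}}_{k,i},\quad \mathbf{O}_{k,ij}=\hat{\mathbf{P}}_{k,i}^{-1}\hat{\mathbf{Y}}_{k,ij},$$ where the next switching time is $t_{k+1}=t_k+T_k$ with $$T_k=\frac12\min\left\{\frac{-\lambda_{\max}(\mathbf{F}_k+\mathbf{F}_k^T)}{(a+h)\|\mathbf{Z}_k\|+b\|\mathbf{W}_k+\mathbf{Y}_k\|},\ \frac{-\lambda_{\max}(\hat{\mathbf{F}}_k+\hat{\mathbf{F}}_k^T)}{(a+h)\|\hat{\mathbf{P}}_k\|+c\|\hat{\mathbf{W}}_k+\hat{\mathbf{Y}}_k\|}\right\}.$$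 Then the closed-loop system is globally asymptotically stable (i.e. its equilibrium $(\mathbf{x},\mathbf{e})\equiv(\mathbf{0},\mathbf{0})$, $\mathbf{e}=\hat{\mathbf{x}}-\mathbf{x}$, is globally asymptotically stable), and for all $k$ and all $i,j$ the gain bounds $\|\mathbf{K}_{k,i}\|\le\kappa_i$, $\|\mathbf{M}_{k,i}\|\le\mu_i$, $\|\mathbf{L}_{k,ij}\|\le\iota_{ij}$, $\|\mathbf{O}_{k,ij}\|\le\omega_{ij}$ hold.
   Context: $\mathcal N=\{1,\dots,N\}$, $\mathcal N_i=\mathcal N\setminus\{i\}$, $n=\sum_{i\in\mathcal N}n_i$. $\prec,\preceq$ denote the (semi)definite order on symmetric matrices; $\circ$ is the Hadamard (entrywise) product; $\mathbf{1}^{m\times n}$ is the $m\times n$ all-ones matrix; $\mathrm{diag}(\cdot)$ of matrices is block-diagonal; $\|\cdot\|$ is the Euclidean vector norm and induced matrix norm; $\lambda_{\min},\lambda_{\max},\sigma_{\max}$ are smallest eigenvalue, largest eigenvalue, largest singular value. Dimensions: $\mathbf{x}_i,\hat{\mathbf{x}}_i\in\mathbb{R}^{n_i}$, $\mathbf{u}_i\in\mathbb{R}^{m_i}$, $\mathbf{y}_i\in\mathbb{R}^{r_i}$; $\mathbf{Z}_{k,i},\hat{\mathbf{P}}_{k,i}\in\mathbb{R}^{n_i\times n_i}$, $\mathbf{W}_{k,i}\in\mathbb{R}^{m_i\times n_i}$, $\mathbf{Y}_{k,ij}\in\mathbb{R}^{m_i\times n_j}$, $\hat{\mathbf{W}}_{k,i}\in\mathbb{R}^{n_i\times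 r_i}$, $\hat{\mathbf{Y}}_{k,ij}\in\mathbb{R}^{n_i\times r_j}$. $\mathbf{x},\hat{\mathbf{x}}$ are the stacked vectors; $\mathbf{A}(t)=\mathrm{diag}(\mathbf{A}_i(t))$, $\mathbf{B}(t)=\mathrm{diag}(\mathbf{B}_i(t))$, $\mathbf{C}(t)=\mathrm{diag}(\mathbf{C}_i(t))$, $\mathbf{H}(t)=[\mathbf{H}_{ij}(t)]$ with $\mathbf{H}_{ii}\equiv\mathbf{0}$. The constants $\kappa_i,\mu_i,\iota_{ij},\omega_{ij}\ge0$ ($i,j\in\mathcal N$) are fixed design bounds. Standing assumptions: each subsystem is completely controllable and completely observable; $\mathbf{A},\mathbf{B},\mathbf{C},\mathbf{H}$ are continuously differentiable on $t\ge0$ with $\|\dot{\mathbf{A}}(t)\|\le a$, $\|\dot{\mathbf{B}}(t)\|\le b$, $\|\dot{\mathbf{C}}(t)\|\le c$, $\|\dot{\mathbf{H}}(t)\|\le h$ for all $t$; and there is a constant $T_{\min}>0$ with $T_k=t_{k+1}-t_k\ge T_{\min}$ for all $k$. *)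

(* Defs.v *)
(* MathComp / MathComp-Analysis *)
From HB Require Import structures.
From mathcomp Require Export all_boot all_order all_algebra.
From mathcomp Require Export all_classical all_reals all_analysis.
Export Order.TTheory GRing.Theory Num.Theory.
Export numFieldNormedType.Exports.

#[export] Set Implicit Arguments.
#[export] Unset Strict Implicit.
#[export] Unset Printing Implicit Defensive.

Local Open Scope classical_set_scope.
Local Open Scope ring_scope.

Section Matrices.
Variable R : realType.

(* MathComp-Analysis endows matrices with the max norm; the norms below are the
   Euclidean one and the operator norm it induces. *)
Definition enorm p (x : 'cV[R]_p) : R := Num.sqrt (\sum_i x i 0 ^+ 2).

Definition opnorm p q (M : 'M[R]_(p, q)) : R :=
  sup [set enorm (M *m x) | x in [set x : 'cV[R]_q | enorm x <= 1]].

(* Used for symmetric matrices of positive size, whose set of eigenvalues is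
   finite and nonempty. *)
Definition lambda_max p (M : 'M[R]_p) : R := sup [set l | eigenvalue M l].
Definition lambda_min p (M : 'M[R]_p) : R := inf [set l | eigenvalue M l].

Definition sigma_max p q (M : 'M[R]_(p, q)) : R :=
  sup [set Num.sqrt l | l in [set l | eigenvalue (M^T *m M) l]].

Definition psdmx p (M : 'M[R]_p) : Prop :=
  M^T = M /\ forall x : 'cV[R]_p, 0 <= (x^T *m M *m x) 0 0.
Definition pdmx p (M : 'M[R]_p) : Prop :=
  M^T = M /\ forall x : 'cV[R]_p, x != 0 -> 0 < (x^T *m M *m x) 0 0.

Definition hadamard p q (M1 M2 : 'M[R]_(p, q)) : 'M[R]_(p, q) :=
  map2_mx *%R M1 M2.

(* Rectangular counterpart of [mxdiag], which only accepts square blocks; the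
   [conform_mx] transports D i : 'M_(p i, q i) to 'M_(p i, q j) when i == j. *)
Definition blockdiag N (p q : 'I_N -> nat) (D : forall i, 'M[R]_(p i, q i)) :
    'M[R]_(\sum_i p i, \sum_i q i) :=
  \mxblock_(i, j) (if i == j then conform_mx 0 (D i) else 0).

End Matrices.

Section Dynamics.
Variable R : realType.

(* f has derivative df at t along the set D: one-sided at the end points of an
   interval D, two-sided in its interior. *)
Definition deriv_within p q (D : set R) (f : R -> 'M[R]_(p, q)) (t : R)
    (df : 'M[R]_(p, q)) : Prop :=
  (s - t)^-1 *: (f s - f t) @[s --> within D (dnbhs t)] --> df.

Definition C1_deriv_bounded p q (f : R -> 'M[R]_(p, q)) (a : R) : Prop :=
  exists df : R -> 'M[R]_(p, q),
    [/\ forall t, 0 <= t -> deriv_within `[0, +oo[ f t (df t),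
        {within `[0, +oo[, continuous df}
      & forall t, 0 <= t -> opnorm (df t) <= a].

(* x is continuous on D and x' = f holds on D away from the exceptional
   (switching) instants in E. *)
Definition solves p (D E : set R) (x f : R -> 'cV[R]_p) : Prop :=
  {within D, continuous x} /\
  forall t, D t -> ~ E t -> deriv_within D x t (f t).

(* Every state at every initial time can be steered to every other state in
   finite time. *)
Definition completely_controllable p q
    (A : R -> 'M[R]_p) (B : R -> 'M[R]_(p, q)) : Prop :=
  forall (t0 : R) (x0 x1 : 'cV[R]_p), 0 <= t0 ->
  exists (t1 : R) (u : R -> 'cV[R]_q) (x : R -> 'cV[R]_p),
    [/\ t0 < t1, {within `[t0, t1], continuous u},
        solves `[t0, t1] set0 x (fun t => A t *m x t + B t *m u t),
        x t0 = x0 & x t1 = x1].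

(* From every initial time on, input and output over some finite horizon
   determine the initial state. *)
Definition completely_observable p q r (A : R -> 'M[R]_p)
    (B : R -> 'M[R]_(p, q)) (C : R -> 'M[R]_(r, p)) : Prop :=
  forall t0 : R, 0 <= t0 ->
  exists2 t1 : R, t0 < t1 &
    forall (u : R -> 'cV[R]_q) (x x' : R -> 'cV[R]_p),
      {within `[t0, t1], continuous u} ->
      solves `[t0, t1] set0 x (fun t => A t *m x t + B t *m u t) ->
      solves `[t0, t1] set0 x' (fun t => A t *m x' t + B t *m u t) ->
      (forall t, t0 <= t <= t1 -> C t *m x t = C t *m x' t) ->
      x t0 = x' t0.

(* [sol s z]: z is a trajectory on [s, +oo[.  Global asymptotic stability of the
   equilibrium 0 of a time-varying system: for every initial time s, Lyapunov
   stability (delta may depend on s) and attraction of all trajectories. *)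
Definition globally_asymptotically_stable p
    (sol : R -> (R -> 'cV[R]_p) -> Prop) : Prop :=
  [/\ forall s, 0 <= s -> sol s (fun=> 0),
      forall s eps, 0 <= s -> 0 < eps ->
        exists2 delta, 0 < delta & forall z, sol s z -> enorm (z s) < delta ->
          forall t, s <= t -> enorm (z t) < eps
    & forall s z, 0 <= s -> sol s z -> enorm (z t) @[t --> +oo] --> (0 : R)].

End Dynamics.

Section Network.
Variables (R : realType) (N : nat) (n m r : 'I_N -> nat).

(* Trajectories z = (x, e), e = xh - x, on [s, +oo[ of the plant network
   interconnected with the observer-based controller with gains K, L, M, Og that
   switch at the instants in E. *)
Definition closed_loop
    (A : R -> forall i, 'M[R]_(n i))
    (B : R -> forall i, 'M[R]_(n i, m i))
    (C : R -> forall i, 'M[R]_(r i, n i))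
    (H : R -> forall i j, 'M[R]_(n i, n j))
    (K : R -> forall i, 'M[R]_(m i, n i))
    (L : R -> forall i j, 'M[R]_(m i, n j))
    (M : R -> forall i, 'M[R]_(n i, r i))
    (Og : R -> forall i j, 'M[R]_(n i, r j))
    (E : set R) (s : R) (z : R -> 'cV[R]_(\sum_i n i + \sum_i n i)) : Prop :=
  exists (x xh : forall i, R -> 'cV[R]_(n i)) (u : forall i, R -> 'cV[R]_(m i))
    (y : forall i, R -> 'cV[R]_(r i)),
  [/\ forall t, s <= t ->
        z t = col_mx (\mxcol_i x i t) (\mxcol_i (xh i t - x i t)),
      forall i t, s <= t -> y i t = C t i *m x i t,
      forall i t, s <= t ->
        u i t = K t i *m xh i t + \sum_(j | j != i) L t i j *m xh j t,
      forall i, solves `[s, +oo[ E (x i) (fun t =>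
        A t i *m x i t + B t i *m u i t + \sum_(j | j != i) H t i j *m x j t)
    & forall i, solves `[s, +oo[ E (xh i) (fun t =>
        A t i *m xh i t + B t i *m u i t + \sum_(j | j != i) H t i j *m xh j t
        + M t i *m (C t i *m xh i t - y i t)
        + \sum_(j | j != i) Og t i j *m (C t j *m xh j t - y j t))].

Variable beta : 'I_N -> R.

Definition beta_mx : 'M[R]_(\sum_i n i) := \mxdiag_i (const_mx (beta i)).

Definition ctrl_mx (A : forall i, 'M[R]_(n i)) (B : forall i, 'M[R]_(n i, m i))
    (H : forall i j, 'M[R]_(n i, n j)) (Z : forall i, 'M[R]_(n i))
    (W : forall i, 'M[R]_(m i, n i)) (Y : forall i j, 'M[R]_(m i, n j)) :
    'M[R]_(\sum_i n i) :=
  (\mxdiag_i A i + \mxblock_(i, j) H i j) *m \mxdiag_i Z i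
  + blockdiag B *m (blockdiag W + \mxblock_(i, j) Y i j)
  + hadamard beta_mx (\mxdiag_i Z i).

Definition obs_mx (A : forall i, 'M[R]_(n i)) (C : forall i, 'M[R]_(r i, n i))
    (H : forall i j, 'M[R]_(n i, n j)) (Ph : forall i, 'M[R]_(n i))
    (Wh : forall i, 'M[R]_(n i, r i)) (Yh : forall i j, 'M[R]_(n i, r j)) :
    'M[R]_(\sum_i n i) :=
  \mxdiag_i Ph i *m (\mxdiag_i A i + \mxblock_(i, j) H i j)
  + (blockdiag Wh + \mxblock_(i, j) Yh i j) *m blockdiag C
  + hadamard beta_mx (\mxdiag_i Ph i).

(* The quotients are taken in the extended reals, where x / 0 = +oo for x > 0:
   a zero denominator (e.g. a time-invariant network with a = b = c = h = 0)
   imposes no bound on the dwell time. *)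
Definition dwell_time (a b c h : R) (F Fh : 'M[R]_(\sum_i n i))
    (Z Ph : forall i, 'M[R]_(n i))
    (W : forall i, 'M[R]_(m i, n i)) (Y : forall i j, 'M[R]_(m i, n j))
    (Wh : forall i, 'M[R]_(n i, r i)) (Yh : forall i j, 'M[R]_(n i, r j)) :
    \bar R :=
  ((2^-1)%:E * mine
    ((- lambda_max (F + F^T))%:E /
     ((a + h) * opnorm (\mxdiag_i Z i)
      + b * opnorm (blockdiag W + \mxblock_(i, j) Y i j))%:E)
    ((- lambda_max (Fh + Fh^T))%:E /
     ((a + h) * opnorm (\mxdiag_i Ph i)
      + c * opnorm (blockdiag Wh + \mxblock_(i, j) Yh i j))%:E))%E.

End Network.

(* Main.v *)
Require Import Defs.
From mathcomp Require Import ring lra.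
Local Open Scope classical_set_scope.
Local Open Scope ring_scope.

(** Stack the subsystems: with [x], [xh] and [e = xh - x] the stacked vectors, the
    closed loop on step [k] reads
      [x' = (A + H) x + B (W + Y) Z^-1 (x + e)],
      [e' = (A + H) e + P^-1 (Wh + Yh) C e]   ([P] is the stack of the [Ph k i]),
    so the error is autonomous and drives the state ([mul_block_mxcol],
    [mul_invmx_mxdiag]).

    The matrix inequality imposed at [t_k] survives until [t_{k+1}]: [F]
    moves at a rate bounded by [(a + h) |Z| + b |W + Y|], and the dwell time is
    chosen so that twice this drift does not exhaust [- lambda_max (F + F^T)]
    ([ctrl_lmi], [obs_lmi]).  Hence [F(t) + F(t)^T <= 0] on the whole step, and the
    term [beta o Z] in [F] becomes a decay rate [2 alpha], where [0 < alpha <= beta_i] for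
    all [i], of
      [V = x^T Z^-1 x]   and   [Vh = e^T P e],
    up to a coupling [2 (Z^-1 x)^T B K e] in [V'].  At a switching instant both
    functions can only drop, as [Z] grows and [P] decreases with [k].

    The gain [K] is bounded by the design bounds, but [B(t)] is only known to grow at
    most linearly.  This is harmless because [e] decays exponentially: for [G] large,
      [Phi = exp (alpha t) V + G exp (3 alpha t / 2) Vh]
    is nonincreasing along trajectories, the spare factor [exp (alpha t / 2)] in
    front of [Vh] absorbing the square of that linear growth ([V_deriv], [q_le]).
    Since [V] and [Vh] dominate multiples of [|x|^2] and [|e|^2] that do not depend
    on [k], [Phi(t) <= Phi(s)] gives
      [|z(t)|^2 <= K(s) exp (- alpha t) |z(s)|^2]   ([stacked_decay]),
    which contains both stability and attraction ([gas_of_decay]).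

    The gain bounds only use [lambda_min Z |y| <= |Z y|] and [|W y| <= sigma_max W |y|].
    Such facts about extreme eigenvalues rest on [rayleigh]: a real symmetric
    matrix has an eigenvalue that bounds its quadratic form. *)

(** * Euclidean geometry and the largest eigenvalue of a symmetric matrix *)

Section Euclid.
Variable R : realType.

Definition dot p (x y : 'cV[R]_p) : R := (x^T *m y) 0 0.

Lemma dotE p (x y : 'cV[R]_p) : dot x y = \sum_i x i 0 * y i 0.
Proof. by rewrite /dot mxE; apply: eq_bigr => i _; rewrite mxE. Qed.

Lemma dotC p (x y : 'cV[R]_p) : dot x y = dot y x.
Proof. by rewrite !dotE; apply: eq_bigr => i _; rewrite mulrC. Qed.

Lemma dotDr p (x y z : 'cV[R]_p) : dot x (y + z) = dot x y + dot x z.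
Proof. by rewrite /dot mulmxDr mxE. Qed.

Lemma dotZr p k (x y : 'cV[R]_p) : dot x (k *: y) = k * dot x y.
Proof. by rewrite /dot -scalemxAr mxE. Qed.

Lemma dotNr p (x y : 'cV[R]_p) : dot x (- y) = - dot x y.
Proof. by rewrite -scaleN1r dotZr mulN1r. Qed.

Lemma dotDl p (x y z : 'cV[R]_p) : dot (x + y) z = dot x z + dot y z.
Proof. by rewrite ![dot _ z]dotC dotDr. Qed.

Lemma dotZl p k (x y : 'cV[R]_p) : dot (k *: x) y = k * dot x y.
Proof. by rewrite ![dot _ y]dotC dotZr. Qed.

Lemma dotNl p (x y : 'cV[R]_p) : dot (- x) y = - dot x y.
Proof. by rewrite ![dot _ y]dotC dotNr. Qed.

Lemma dot0r p (x : 'cV[R]_p) : dot x 0 = 0.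
Proof. by rewrite -(scale0r (0 : 'cV[R]_p)) dotZr mul0r. Qed.

Lemma dotMl p q (M : 'M[R]_(p, q)) x y : dot (M *m x) y = dot x (M^T *m y).
Proof. by rewrite /dot trmx_mul mulmxA. Qed.

Lemma mulmx_dot p q (M : 'M[R]_(p, q)) (x : 'cV_p) (y : 'cV_q) :
  (x^T *m M *m y) 0 0 = dot x (M *m y).
Proof. by rewrite /dot mulmxA. Qed.

Lemma dot_ge0 p (x : 'cV[R]_p) : 0 <= dot x x.
Proof. by rewrite dotE; apply: sumr_ge0 => i _; rewrite -expr2 sqr_ge0. Qed.

Lemma dot_eq0 p (x : 'cV[R]_p) : (dot x x == 0) = (x == 0).
Proof.
apply/eqP/eqP => [|->]; last by rewrite dot0r.
rewrite dotE => /eqP; rewrite psumr_eq0 => [/allP x0|i _]; last first.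
  by rewrite -expr2 sqr_ge0.
apply/matrixP => i j; rewrite ord1 mxE; apply/eqP.
by have := x0 i (mem_index_enum _); rewrite -expr2 sqrf_eq0.
Qed.

Lemma dot_gt0 p (x : 'cV[R]_p) : x != 0 -> 0 < dot x x.
Proof. by rewrite -dot_eq0 lt0r dot_ge0 andbT. Qed.

Lemma psdmx_dot p (M : 'M[R]_p) (x : 'cV_p) : psdmx M -> 0 <= dot x (M *m x).
Proof. by case=> _ /(_ x); rewrite mulmx_dot. Qed.

Lemma dot_swap p (M : 'M[R]_p) (x y : 'cV_p) : M^T = M ->
  dot x (M *m y) = dot y (M *m x).
Proof. by move=> sM; rewrite dotC dotMl sM. Qed.

(** The quadratic [s^2 u + 2 s t v + t^2 w] is nonnegative.  Taking
    [(s, t) = (w, - v)] gives [w (u w - v^2) >= 0], enough when [w > 0]; when [w = 0],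
    [(s, t) = (v, - (u + 1) / 2)] forces [v = 0]. *)
Lemma psd_cauchy_schwarz p (M : 'M[R]_p) (x y : 'cV_p) : psdmx M ->
  dot x (M *m y) ^+ 2 <= dot x (M *m x) * dot y (M *m y).
Proof.
move=> pM; have [sM _] := pM.
set u := dot x (M *m x); set v := dot x (M *m y); set w := dot y (M *m y).
have w0 : 0 <= w by exact: psdmx_dot.
rewrite le_eqVlt in w0.
have H s t : 0 <= s ^+ 2 * u + 2 * s * t * v + t ^+ 2 * w.
  suff -> : s ^+ 2 * u + 2 * s * t * v + t ^+ 2 * w =
      dot (s *: x + t *: y) (M *m (s *: x + t *: y)) by exact: psdmx_dot.
  rewrite mulmxDr -!scalemxAr !(dotDl, dotDr, dotZl, dotZr).
  by rewrite (dot_swap y x sM) -/u -/v -/w; ring.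
have := H w (- v); have := H v (- (u + 1) / 2).
case/predU1P: w0 => [<-|]; nra.
Qed.

Lemma enormE p (x : 'cV[R]_p) : enorm x = Num.sqrt (dot x x).
Proof. by rewrite dotE. Qed.

Lemma enorm_ge0 p (x : 'cV[R]_p) : 0 <= enorm x.
Proof. exact: sqrtr_ge0. Qed.

Lemma enorm_sqr p (x : 'cV[R]_p) : enorm x ^+ 2 = dot x x.
Proof. by rewrite enormE sqr_sqrtr// dot_ge0. Qed.

Lemma enorm0 p : enorm (0 : 'cV[R]_p) = 0.
Proof. by rewrite enormE dot0r sqrtr0. Qed.

Lemma enorm_eq0 p (x : 'cV[R]_p) : (enorm x == 0) = (x == 0).
Proof. by rewrite enormE sqrtr_eq0 -dot_eq0 eq_le dot_ge0 andbT. Qed.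

Lemma enormZ p k (x : 'cV[R]_p) : enorm (k *: x) = `|k| * enorm x.
Proof.
by rewrite !enormE dotZl dotZr mulrA -expr2 sqrtrM ?sqr_ge0// sqrtr_sqr.
Qed.

Lemma psdmx1 p : psdmx (1%:M : 'M[R]_p).
Proof. by split=> [|x]; rewrite ?trmx1// mulmx_dot mul1mx dot_ge0. Qed.

Lemma cauchy_schwarz p (x y : 'cV[R]_p) : `|dot x y| <= enorm x * enorm y.
Proof.
rewrite -(@ler_pXn2r _ 2)// ?nnegrE ?mulr_ge0 ?enorm_ge0//.
rewrite real_normK ?num_real// exprMn !enorm_sqr.
by have := psd_cauchy_schwarz x y (psdmx1 p); rewrite !mul1mx.
Qed.

Lemma form_bounded p (M : 'M[R]_p) :
  exists2 c : R, 0 < c & forall x : 'cV_p, `|dot x (M *m x)| <= c * dot x x.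
Proof.
exists (1 + \sum_i \sum_j `|M i j|) => [|x].
  by rewrite ltr_pwDl// sumr_ge0// => i _; rewrite sumr_ge0.
have xi i : x i 0 ^+ 2 <= dot x x.
  rewrite dotE (bigD1 i)//= -expr2 lerDl sumr_ge0// => j _.
  by rewrite -expr2 sqr_ge0.
rewrite mulrDl mul1r -[leLHS]add0r lerD ?dot_ge0//.
rewrite [dot x (_ *m _)]dotE mulr_suml; apply: le_trans (ler_norm_sum _ _ _) _.
apply: ler_sum => i _; rewrite mxE mulr_sumr mulr_suml.
apply: le_trans (ler_norm_sum _ _ _) _; apply: ler_sum => j _.
rewrite mulrCA normrM ler_wpM2l// ler_norml.
have := xi i; have := xi j; nra.
Qed.

(** Cauchy-Schwarz for the form of [M], applied to [x] and [M^-1 x], bounds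
    [|x|^4] by [x^T M x] times [x^T M^-1 x], and the latter is at most [c |x|^2].
    This replaces a compactness argument on the unit sphere. *)
Lemma psd_unit_coercive p (M : 'M[R]_p) : psdmx M -> M \in unitmx ->
  exists2 d : R, 0 < d & forall x : 'cV_p, d * dot x x <= dot x (M *m x).
Proof.
move=> pM uM; have [c c0 cM] := form_bounded (invmx M).
exists c^-1 => [|x]; first by rewrite invr_gt0.
rewrite mulrC ler_pdivrMr//.
have [->|x0] := eqVneq x 0; first by rewrite dot0r mulmx0 dot0r mul0r.
have := psd_cauchy_schwarz x (invmx M *m x) pM.
rewrite mulKVmx// [dot (invmx M *m x) x]dotC.
have := cM x; rewrite ler_norml => /andP[_ h1] h2.
have d0 := dot_gt0 x0; have := psdmx_dot x pM.
move: (dot x (M *m x)) h2 => q h2 q0; rewrite -(ler_pM2l d0); nra.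
Qed.

Lemma sym_eigenvalue p (M : 'M[R]_p) l : M^T = M ->
  eigenvalue M l -> exists2 x : 'cV_p, x != 0 & M *m x = l *: x.
Proof.
move=> sM /eigenvalueP[v vM v0]; exists v^T; first by rewrite trmx_eq0.
by rewrite -{1}sM -trmx_mul vM linearZ.
Qed.

(** Let [mu] be the least number with [M <= mu].  Then [mu - M] is positive
    semidefinite; if it were invertible it would be coercive, and [mu] could be
    lowered.  So [mu] is an eigenvalue. *)
Lemma rayleigh p (M : 'M[R]_p.+1) : M^T = M ->
  exists2 l : R, eigenvalue M l & forall x : 'cV_p.+1, dot x (M *m x) <= l * dot x x.
Proof.
move=> sM; pose E := [set l : R | forall x : 'cV_p.+1, dot x (M *m x) <= l * dot x x].
have E0 : E !=set0.
  by have [c _ cM] := form_bounded M; exists c => x; apply: le_trans (cM x); apply: ler_norm.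
pose e : 'cV[R]_p.+1 := delta_mx 0 0.
have e0 : 0 < dot e e.
  apply: dot_gt0; apply/eqP => /matrixP/(_ 0 0); rewrite !mxE eqxx/= => /eqP.
  by rewrite oner_eq0.
have lE : has_lbound E.
  by exists (dot e (M *m e) / dot e e) => l /(_ e); rewrite -ler_pdivrMr.
have infE : E (inf E).
  move=> x; have [->|x0] := eqVneq x 0; first by rewrite mulmx0 !dot0r mulr0.
  rewrite -ler_pdivrMr ?dot_gt0//; apply: lb_le_inf => // l /(_ x).
  by rewrite -ler_pdivrMr ?dot_gt0.
exists (inf E) => //.
pose D := (inf E)%:M - M.
have DE x : dot x (D *m x) = inf E * dot x x - dot x (M *m x).
  by rewrite mulmxDl mulNmx mul_scalar_mx dotDr dotNr dotZr.
have pD : psdmx D.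
  split=> [|x]; first by rewrite linearB/= tr_scalar_mx sM.
  by rewrite mulmx_dot DE subr_ge0.
have nD : D \notin unitmx.
  apply/negP => /(psd_unit_coercive pD)[d d0 dD].
  have /(ge_inf lE) : E (inf E - d).
    by move=> x; have := dD x; rewrite DE mulrBl; lra.
  by lra.
rewrite /eigenvalue /eigenspace kermx_eq0 row_free_unit.
by rewrite -[M - _]opprB -scaleN1r unitmxZ ?unitrN1.
Qed.
End Euclid.

(** * Extreme eigenvalues, singular values and gain bounds *)

Section Spectral.
Variable R : realType.

Lemma eigenvalue_le p (M : 'M[R]_p) c l : M^T = M ->
  (forall x, dot x (M *m x) <= c * dot x x) -> eigenvalue M l -> l <= c.
Proof.
move=> sM Mc /(sym_eigenvalue sM)[x x0 Mx].
by have := Mc x; rewrite Mx dotZr ler_pM2r ?dot_gt0.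
Qed.

Lemma lambda_max_ge p (M : 'M[R]_p) (x : 'cV_p) : M^T = M ->
  dot x (M *m x) <= lambda_max M * dot x x.
Proof.
case: p M x => [|p] M x sM; first by rewrite [x]flatmx0 mulmx0 !dot0r mulr0.
have [l Ml lM] := rayleigh sM; apply: le_trans (lM x) _.
rewrite ler_wpM2r ?dot_ge0//; apply: ub_le_sup => //.
by exists l => l'; apply: eigenvalue_le.
Qed.

(** The assumption [0 <= c] covers dimension 0, where the set of eigenvalues is
    empty and [lambda_max M] is 0 by convention. *)
Lemma lambda_max_le p (M : 'M[R]_p) c : M^T = M -> 0 <= c ->
  (forall x, dot x (M *m x) <= c * dot x x) -> lambda_max M <= c.
Proof.
move=> sM c0 Mc; case: (pselect ([set l | eigenvalue M l] !=set0)) => E0.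
  by apply: ge_sup => // l; apply: eigenvalue_le.
by rewrite /lambda_max; move/set0P/negP/negPn/eqP: E0 => ->; rewrite sup0.
Qed.

Lemma lambda_minE p (M : 'M[R]_p) : lambda_min M = - lambda_max (- M).
Proof.
rewrite /lambda_min /lambda_max /inf; congr (- sup _).
apply/seteqP; split=> l /=.
  case=> k /eigenvalueP[v vM v0] <-; apply/eigenvalueP.
  by exists v => //; rewrite mulmxN vM scaleNr.
move=> /eigenvalueP[v vM v0]; exists (- l); rewrite ?opprK//.
by apply/eigenvalueP; exists v => //; rewrite scaleNr -vM mulmxN opprK.
Qed.

Lemma lambda_min_le p (M : 'M[R]_p) (x : 'cV_p) : M^T = M ->
  lambda_min M * dot x x <= dot x (M *m x).
Proof.
move=> sM; rewrite lambda_minE mulNr lerNl -dotNr -mulNmx.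
by apply: lambda_max_ge; rewrite linearN/= sM.
Qed.

Lemma lambda_min_gt0 p (M : 'M[R]_p.+1) : pdmx M -> 0 < lambda_min M.
Proof.
move=> [sM pM]; have sN : (- M)^T = - M by rewrite linearN/= sM.
rewrite lambda_minE oppr_gt0.
have [l Ml lM] := rayleigh sN; apply: le_lt_trans (_ : l < 0).
  by apply: ge_sup => [|k]; [exists l | apply: eigenvalue_le].
have [x x0 Mx] := sym_eigenvalue sN Ml; have := pM x x0.
rewrite mulmx_dot -[M]opprK mulNmx Mx dotNr dotZr.
by have := dot_gt0 x0; nra.
Qed.

Lemma pdmx_coercive p (M : 'M[R]_p) : pdmx M ->
  exists2 d : R, 0 < d & forall x : 'cV_p, d * dot x x <= dot x (M *m x).
Proof.
case: p M => [|p] M pM.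
  by exists 1 => // x; rewrite [x]flatmx0 mulmx0 !dot0r mulr0.
exists (lambda_min M) => [|x]; first exact: lambda_min_gt0.
by apply: lambda_min_le; case: pM.
Qed.

Lemma coercive_unitmx p (M : 'M[R]_p) d : 0 < d ->
  (forall x : 'cV_p, d * dot x x <= dot x (M *m x)) -> M \in unitmx.
Proof.
move=> d0 dM; rewrite -unitmx_tr -row_free_unit; apply/row_freeP.
apply/row_freeP; rewrite -kermx_eq0; apply/eqP/row_matrixP => i.
have /sub_kermxP : (row i (kermx M^T) <= kermx M^T)%MS by exact: row_sub.
move: (row i _) => v vM; rewrite row0.
have Mv : M *m v^T = 0 by apply: trmx_inj; rewrite trmx_mul trmxK vM trmx0.
have := dM v^T; rewrite Mv dot0r => h; apply: trmx_inj; rewrite trmx0; apply/eqP.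
by rewrite -dot_eq0; have := dot_ge0 v^T; nra.
Qed.

Lemma pdmx_unit p (M : 'M[R]_p) : pdmx M -> M \in unitmx.
Proof. by move=> /pdmx_coercive[d d0]; apply: coercive_unitmx. Qed.

Lemma lambda_min_enorm p (M : 'M[R]_p) (x : 'cV_p) : M^T = M ->
  lambda_min M * enorm x <= enorm (M *m x).
Proof.
move=> sM; have [->|x0] := eqVneq x 0; first by rewrite mulmx0 !enorm0 mulr0.
have n0 : 0 < enorm x by rewrite lt0r enorm_eq0 x0 enorm_ge0.
rewrite -(ler_pM2r n0) -mulrA -expr2 enorm_sqr; apply: le_trans (lambda_min_le x sM) _.
by rewrite mulrC; apply: le_trans (ler_norm _) (cauchy_schwarz _ _).
Qed.

Lemma gram_dot p q (W : 'M[R]_(p, q)) (x : 'cV_q) :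
  dot x (W^T *m W *m x) = dot (W *m x) (W *m x).
Proof. by rewrite dotMl mulmxA. Qed.

Lemma enorm_sigma p q (W : 'M[R]_(p, q)) (x : 'cV_q) :
  enorm (W *m x) <= sigma_max W * enorm x.
Proof.
case: q W x => [|q] W x; first by rewrite [x]flatmx0 mulmx0 !enorm0 mulr0.
have sG : (W^T *m W)^T = W^T *m W by rewrite trmx_mul trmxK.
have [l Gl lG0] := rayleigh sG.
have lG y : dot (W *m y) (W *m y) <= l * dot y y by rewrite -gram_dot; apply: lG0.
have l0 : 0 <= l.
  have [v v0 Gv] := sym_eigenvalue sG Gl.
  have := dot_ge0 (W *m v); rewrite -gram_dot Gv dotZr.
  by rewrite pmulr_lge0// dot_gt0.
apply: le_trans (_ : Num.sqrt l * enorm x <= _).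
  by rewrite !enormE -sqrtrM// ler_wsqrtr.
rewrite ler_wpM2r ?enorm_ge0//; apply: ub_le_sup; last by exists l.
exists (Num.sqrt l) => _ [k Gk <-]; apply: ler_wsqrtr.
by apply: eigenvalue_le Gk => // y; rewrite gram_dot.
Qed.

Lemma sigma_max_ge0 p q (W : 'M[R]_(p, q)) : 0 <= sigma_max W.
Proof.
rewrite /sigma_max; set E := [set _ | _ in _].
have [supE|nE] := pselect (has_sup E); last by rewrite sup_out.
have [[x Ex] uE] := supE; have [l El _] := Ex.
by apply: le_trans (sqrtr_ge0 l) _; apply: ub_le_sup => //; exists l.
Qed.

Lemma enorm_opnorm p q (M : 'M[R]_(p, q)) (x : 'cV_q) :
  enorm (M *m x) <= opnorm M * enorm x.
Proof.
have [->|x0] := eqVneq x 0; first by rewrite mulmx0 !enorm0 mulr0.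
have n0 : 0 < enorm x by rewrite lt0r enorm_eq0 x0 enorm_ge0.
have nV : 0 <= (enorm x)^-1 by rewrite invr_ge0 ltW.
rewrite -ler_pdivrMr//; apply: ub_le_sup.
  exists (sigma_max M) => _ [y /= y1 <-]; apply: le_trans (enorm_sigma _ _) _.
  by rewrite ler_piMr// sigma_max_ge0.
exists ((enorm x)^-1 *: x) => /=; first by rewrite enormZ ger0_norm// mulVf// gt_eqF.
by rewrite -scalemxAr enormZ ger0_norm// mulrC.
Qed.

Lemma opnorm_le p q (M : 'M[R]_(p, q)) c : 0 <= c ->
  (forall x : 'cV_q, enorm (M *m x) <= c * enorm x) -> opnorm M <= c.
Proof.
move=> c0 Mc; apply: ge_sup => [|_ [x /= x1 <-]].
  by exists (enorm (M *m 0)), 0 => //=; rewrite enorm0.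
by apply: le_trans (Mc x) _; rewrite ler_piMr.
Qed.

Lemma opnorm_ge0 p q (M : 'M[R]_(p, q)) : 0 <= opnorm M.
Proof.
apply: le_trans (enorm_ge0 (M *m 0)) _; apply: ub_le_sup; last first.
  by exists 0; rewrite //= enorm0.
exists (sigma_max M) => _ [y /= y1 <-]; apply: le_trans (enorm_sigma _ _) _.
by rewrite ler_piMr// sigma_max_ge0.
Qed.

Lemma dot_opnorm p q (M : 'M[R]_(p, q)) x y :
  `|dot x (M *m y)| <= opnorm M * (enorm x * enorm y).
Proof.
apply: le_trans (cauchy_schwarz _ _) _.
by rewrite mulrCA ler_wpM2l ?enorm_ge0// enorm_opnorm.
Qed.

(** With [y = Z^-1 x]: [|W y| <= sigma_max W |y| <= k lambda_min Z |y| <= k |Z y|]. *)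
Lemma state_gain_bound p q (W : 'M[R]_(p, q)) (Z : 'M[R]_q) k : 0 <= k ->
  pdmx Z -> 0 <= k * lambda_min Z - sigma_max W -> opnorm (W *m invmx Z) <= k.
Proof.
move=> k0 pZ; rewrite subr_ge0 => h; apply: opnorm_le => // x.
have uZ := pdmx_unit pZ; have [sZ _] := pZ.
rewrite -{2}(mulKVmx uZ x) -mulmxA; set y := invmx Z *m x.
apply: le_trans (enorm_sigma _ _) _; apply: le_trans (_ : k * lambda_min Z * enorm y <= _).
  by rewrite ler_wpM2r ?enorm_ge0.
by rewrite -mulrA ler_wpM2l// lambda_min_enorm.
Qed.

(** Dual estimate, with [y = P^-1 W x]: [lambda_min P |y| <= |P y| = |W x|], and
    [|W x| <= k lambda_min P |x|]; the factor [lambda_min P] cancels. *)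
Lemma injection_gain_bound p q (W : 'M[R]_(p, q)) (P : 'M[R]_p) k : 0 <= k ->
  pdmx P -> 0 <= k * lambda_min P - sigma_max W -> opnorm (invmx P *m W) <= k.
Proof.
move=> k0 pP; rewrite subr_ge0 => h; apply: opnorm_le => // x.
case: p W P pP h => [|p] W P pP h.
  by rewrite [_ *m _ *m x]flatmx0 enorm0 mulr_ge0 ?enorm_ge0.
have uP := pdmx_unit pP; have [sP _] := pP.
rewrite -(ler_pM2l (lambda_min_gt0 pP)).
apply: le_trans (lambda_min_enorm _ sP) _.
rewrite mulmxA mulKVmx//; apply: le_trans (enorm_sigma _ _) _.
by rewrite mulrCA mulrA ler_wpM2r ?enorm_ge0.
Qed.
End Spectral.

(** * Derivatives, monotonicity and mean value inequalities *)

Section Analysis.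
Variable R : realType.

Lemma cvg_sumr (T : Type) (F : set_system T) {FF : Filter F} I (r : seq I)
    (f : I -> T -> R) (l : I -> R) :
  (forall i, f i x @[x --> F] --> l i) ->
  \sum_(i <- r) f i x @[x --> F] --> \sum_(i <- r) l i.
Proof.
move=> fl; elim: r => [|i r IH].
  by rewrite big_nil; under eq_fun do rewrite big_nil; exact: cvg_cst.
by rewrite big_cons; under eq_fun do rewrite big_cons; exact: cvgD.
Qed.

Lemma is_derive_sumr (V : normedModType R) I (r : seq I) (f : I -> V -> R) (df : I -> R) (x v : V) :
  (forall i, is_derive x v (f i) (df i)) ->
  is_derive x v (fun y => \sum_(i <- r) f i y) (\sum_(i <- r) df i).
Proof.
move=> fd; elim: r => [|i r IH].
  by rewrite big_nil; under eq_fun do rewrite big_nil; exact: is_derive_cst.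
by rewrite big_cons; under eq_fun do rewrite big_cons; exact: is_deriveD.
Qed.

Lemma is_derive_mull (g : R -> R) (c t dg : R) : is_derive t 1 g dg ->
  is_derive t 1 (fun s => c * g s) (c * dg).
Proof. by move=> gd; exact: (@is_deriveZ _ _ _ g c t 1 dg gd). Qed.

Lemma is_derive_mulr (f g : R -> R) (t df dg : R) : is_derive t 1 f df ->
  is_derive t 1 g dg -> is_derive t 1 (fun s => f s * g s) (df * g t + f t * dg).
Proof.
move=> fd gd; apply: is_derive_eq (@is_deriveM _ _ f g t 1 df dg fd gd) _.
by rewrite /GRing.scale/= addrC mulrC.
Qed.

Lemma cvg_dotmx (T : Type) (F : set_system T) {FF : Filter F} p q
    (f : T -> 'M[R]_(p, q)) (l : 'M[R]_(p, q)) w v :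
  f x @[x --> F] --> l -> dot w (f x *m v) @[x --> F] --> dot w (l *m v).
Proof.
move=> fl; under eq_fun do rewrite dotE; rewrite dotE; apply: cvg_sumr => i.
apply: cvgM; first exact: cvg_cst.
under eq_fun do rewrite mxE; rewrite mxE; apply: cvg_sumr => j.
apply: cvgM; last exact: cvg_cst.
exact: (cvg_comp _ _ fl (@coord_continuous _ _ _ i j l)).
Qed.

Lemma cvg_entry (T : Type) (F : set_system T) {FF : Filter F} p q
    (f : T -> 'M[R]_(p, q)) (l : 'M[R]_(p, q)) i j :
  f x @[x --> F] --> l -> f x i j @[x --> F] --> l i j.
Proof. by move=> fl; exact: (cvg_comp _ _ fl (@coord_continuous _ _ _ i j l)). Qed.

(** In the interior of [D] the derivative relative to [D] is the usual one, which
    gives access to the calculus of [is_derive]. *)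
Lemma is_derive_within (D : set R) (g : R -> R) t dg : nbhs t D ->
  (s - t)^-1 * (g s - g t) @[s --> within D t^'] --> dg ->
  is_derive t 1 g dg.
Proof.
move=> Dt gd.
have {}gd : (s - t)^-1 * (g s - g t) @[s --> t^'] --> dg.
  move=> U /gd; rewrite /fmap /within /= /nbhs/= => h.
  rewrite /dnbhs /within /= in h *; near=> s => st.
  have : D s by near: s.
  by move: st; near: s.
have H : h^-1 *: ((g \o shift t) (h *: 1) - g t) @[h --> 0^'] --> dg.
  move=> U /gd; rewrite /fmap /nbhs/= /dnbhs /within/= => h.
  have {}h : \forall s \near t, s != t -> U ((s - t)^-1 * (g s - g t)) by [].
  rewrite (near_shift 0 t) in h.
  apply: filterS h => z /=; rewrite subr0 addrK -subr_eq0 addrK => h z0.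
  by rewrite /GRing.scale/= mulr1; apply: h.
split; first by apply/cvg_ex; exists dg.
by rewrite /derive; apply/cvg_lim.
Unshelve. all: by end_near. Qed.

Lemma cvg_within_deriv (D : set R) (g : R -> R) (t dg : R) :
  (s - t)^-1 * (g s - g t) @[s --> within D t^'] --> dg ->
  g s @[s --> within D (nbhs t)] --> g t.
Proof.
move=> gd.
have idc : (s - t) @[s --> within D t^'] --> (0 : R).
  apply: cvg_within_filter.
  have idt : s @[s --> t^'] --> t by exact: nbhs_dnbhs.
  have : s - t @[s --> t^'] --> t - t by apply: cvgB idt _; exact: cvg_cst.
  by rewrite subrr.
have gc : g t + (s - t) * ((s - t)^-1 * (g s - g t)) @[s --> within D t^'] --> g t.
  rewrite -[X in _ --> X]addr0 -(mul0r dg).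
  by apply: cvgD; [exact: cvg_cst | exact: cvgM].
move=> U Ug.
have h : \forall s \near t, s != t -> D s -> U (g t + (s - t) * ((s - t)^-1 * (g s - g t))).
  exact: gc Ug.
suff : \forall s \near t, D s -> U (g s) by [].
apply: filterS h => s h Ds; have [->|st] := eqVneq s t; first exact: nbhs_singleton Ug.
by have := h st Ds; rewrite mulVKf ?subr_eq0// addrC subrK.
Qed.

Lemma nonincreasing_segment (f : R -> R) (df : R -> R) a b : a <= b ->
  {within `[a, b], continuous f} ->
  (forall t, a < t < b -> is_derive t 1 f (df t)) ->
  (forall t, a < t < b -> df t <= 0) -> f b <= f a.
Proof.
move=> ab cf fd df0.
apply: (@ler0_derive1_le_cc _ f a b) => //; rewrite ?in_itv/= ?lexx ?ab//.
  by move=> x; rewrite in_itv/= => /fd[].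
by move=> x; rewrite in_itv/= derive1E => xab; have [_ ->] := fd x xab; exact: df0.
Qed.

Lemma deriv_within_dot (D : set R) p q (f : R -> 'M[R]_(p, q)) t df w v :
  deriv_within D f t df ->
  (s - t)^-1 * (dot w (f s *m v) - dot w (f t *m v)) @[s --> within D t^']
    --> dot w (df *m v).
Proof.
move=> fd.
rewrite (_ : (fun s => _) = fun s => dot w (((s - t)^-1 *: (f s - f t)) *m v)).
  exact: cvg_dotmx fd.
by apply/funext => s; rewrite -scalemxAl dotZr mulmxBl dotDr dotNr.
Qed.

Lemma deriv_within_entry (D : set R) p q (f : R -> 'M[R]_(p, q)) t df i j :
  nbhs t D -> deriv_within D f t df ->
  is_derive t 1 (fun s => f s i j) (df i j).
Proof.
move=> Dt fd; apply: (is_derive_within Dt).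
rewrite (_ : (fun s => _) = fun s => ((s - t)^-1 *: (f s - f t)) i j).
  exact: cvg_entry fd.
by apply/funext => s; rewrite !mxE.
Qed.

(** The derivative of [u |-> w^T f(u) v] is at most [a |w| |v|], so that function minus
    its linear majorant is nonincreasing. *)
Lemma C1_increment p q (f : R -> 'M[R]_(p, q)) a (s t : R) w v :
  C1_deriv_bounded f a -> 0 <= s -> s <= t ->
  dot w (f t *m v) - dot w (f s *m v) <= a * (t - s) * (enorm w * enorm v).
Proof.
move=> [df [fd _ dfa]] s0 st.
pose c := a * (enorm w * enorm v).
pose g u := dot w (f u *m v).
suff : g t - c * t <= g s - c * s by rewrite /g /c; lra.
have gd u : 0 <= u ->
    (x - u)^-1 * (g x - g u) @[x --> within `[0, +oo[ u^'] --> dot w (df u *m v).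
  by move=> u0; apply: deriv_within_dot; exact: fd.
apply: (@nonincreasing_segment (fun u => g u - c * u) (fun u => dot w (df u *m v) - c)) => //.
- have cg : {within `[0, +oo[, continuous g}.
    apply/subspace_continuousP => u; rewrite /= in_itv/= andbT => u0.
    exact: cvg_within_deriv (gd u u0).
  have {}cg : {within `[s, t], continuous g}.
    apply: continuous_subspaceW cg => u /=; rewrite !in_itv/= andbT => /andP[su _].
    exact: le_trans su.
  move=> u; apply: cvgB; first exact: cg.
  apply: cvgM; first exact: cvg_cst.
  by move: u; apply: continuous_subspaceT => u; exact: cvg_id.
- move=> u /andP[su ut]; have u0 : 0 < u by exact: le_lt_trans su.
  have gu : is_derive u 1 g (dot w (df u *m v)).
    apply: is_derive_within (gd u (ltW u0)).
    by apply: filterS (lt_nbhsr u0) => x /= x0; rewrite in_itv/= ltW.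
  apply: is_deriveB; have := is_derive_mull c (is_derive_id u (1 : R)).
  by rewrite mulr1.
- move=> u /andP[su ut]; have u0 : 0 <= u by apply: ltW; exact: le_lt_trans su.
  rewrite subr_le0 /c; apply: le_trans (ler_norm _) _.
  apply: le_trans (dot_opnorm _ _ _) _.
  by rewrite ler_wpM2r ?mulr_ge0 ?enorm_ge0// dfa.
Qed.

Lemma C1_bound_ge0 p q (f : R -> 'M[R]_(p, q)) a : C1_deriv_bounded f a -> 0 <= a.
Proof. by move=> [df [_ _ dfa]]; apply: le_trans (dfa 0 (lexx _)); exact: opnorm_ge0. Qed.

(** A bounded derivative only bounds the matrix itself by an affine function of time. *)
Lemma C1_growth p q (f : R -> 'M[R]_(p, q)) a (t : R) w v :
  C1_deriv_bounded f a -> 0 <= t ->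
  dot w (f t *m v) <= (opnorm (f 0) + a * t) * (enorm w * enorm v).
Proof.
move=> fa t0; have := C1_increment w v fa (lexx 0) t0; rewrite subr0.
have := le_trans (ler_norm _) (dot_opnorm (f 0) w v); lra.
Qed.

(** Stated entrywise, so that the calculus of real-valued functions applies. *)
Definition vderiv p (x : R -> 'cV[R]_p) (t : R) (dx : 'cV[R]_p) :=
  forall i, is_derive t 1 (fun s => x s i 0) (dx i 0).

Lemma is_derive_dot p (x y : R -> 'cV[R]_p) t dx dy :
  vderiv x t dx -> vderiv y t dy ->
  is_derive t 1 (fun s => dot (x s) (y s)) (dot dx (y t) + dot (x t) dy).
Proof.
move=> xd yd; under eq_fun do rewrite dotE.
apply: is_derive_eq.
  by apply: is_derive_sumr => i; exact: (is_derive_mulr (xd i) (yd i)).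
by rewrite big_split/= !dotE.
Qed.

Lemma vderiv_mulmx p q (M : 'M[R]_(p, q)) (x : R -> 'cV[R]_q) t dx :
  vderiv x t dx -> vderiv (fun s => M *m x s) t (M *m dx).
Proof.
move=> xd i; under eq_fun do rewrite mxE; rewrite mxE.
by apply: is_derive_sumr => j; exact: is_derive_mull.
Qed.

Lemma vderivB p (x y : R -> 'cV[R]_p) t dx dy :
  vderiv x t dx -> vderiv y t dy -> vderiv (fun s => x s - y s) t (dx - dy).
Proof.
move=> xd yd i; under eq_fun do rewrite !mxE; rewrite !mxE.
by apply: is_deriveB; [exact: xd | exact: yd].
Qed.

Lemma cvg_dot (T : Type) (F : set_system T) {FF : Filter F} p
    (x y : T -> 'cV[R]_p) (a b : 'cV[R]_p) :
  (forall i, x s i 0 @[s --> F] --> a i 0) -> (forall i, y s i 0 @[s --> F] --> b i 0) ->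
  dot (x s) (y s) @[s --> F] --> dot a b.
Proof.
move=> xa yb; under eq_fun do rewrite dotE; rewrite dotE.
by apply: cvg_sumr => i; apply: cvgM.
Qed.

Lemma cvg_mulmx_entry (T : Type) (F : set_system T) {FF : Filter F} p q
    (M : 'M[R]_(p, q)) (x : T -> 'cV[R]_q) (a : 'cV[R]_q) i :
  (forall i, x s i 0 @[s --> F] --> a i 0) ->
  (M *m x s) i 0 @[s --> F] --> (M *m a) i 0.
Proof.
move=> xa; under eq_fun do rewrite mxE; rewrite mxE.
by apply: cvg_sumr => j; apply: cvgM; first exact: cvg_cst.
Qed.
End Analysis.

(** * Matrix inequalities with drifting coefficients *)

Section Lyapunov.
Variable R : realType.

Lemma C1_increment_norm p q (f : R -> 'M[R]_(p, q)) a (s t : R) v :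
  C1_deriv_bounded f a -> 0 <= s -> s <= t ->
  enorm ((f t - f s) *m v) <= a * (t - s) * enorm v.
Proof.
move=> fa s0 st; set y := _ *m v.
have := C1_increment y v fa s0 st.
rewrite -dotNr -dotDr -mulmxBl -/y -enorm_sqr.
have [->|y0] := eqVneq (enorm y) 0.
  by rewrite !mulr_ge0 ?enorm_ge0 ?subr_ge0// (C1_bound_ge0 fa).
have {y0}y0 : 0 < enorm y by rewrite lt0r y0 enorm_ge0.
by rewrite expr2 mulrCA ler_pM2l.
Qed.

(** As [2 v^T M v = v^T (M + M^T) v], raising the form of [M0] by at most [D |v|^2]
    raises the largest eigenvalue of [M0 + M0^T] by at most [2 D]. *)
Lemma perturbed_lmi p (M0 M1 : 'M[R]_p) D w :
  lambda_max (M0 + M0^T) + 2 * D <= 0 ->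
  (forall v, dot v ((M1 - M0) *m v) <= D * dot v v) ->
  dot w (M1 *m w) <= 0.
Proof.
move=> lD dM.
have sS : (M0 + M0^T)^T = M0 + M0^T by rewrite linearD/= trmxK addrC.
have := lambda_max_ge w sS; have := dM w; have := dot_ge0 w.
rewrite mulmxBl mulmxDl !dotDr dotNr [dot w (M0^T *m w)]dotC dotMl trmxK.
by nra.
Qed.

Lemma subr_sum3 (V : zmodType) (x1 x2 x3 y1 y2 y3 d : V) :
  (x1 + x2 + x3 + d) - (y1 + y2 + y3 + d) = (x1 - y1) + (x2 - y2) + (x3 - y3).
Proof. by rewrite opprD addrACA subrr addr0 opprD addrACA opprD [x1 + _ + _]addrACA. Qed.

(** Why the dwell time has its form: [w^T (F t - F s) w] is at most
    [(t - s) ((a + h) |Z| + b |W|) |w|^2] by the mean value inequality, which the margin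
    [- lambda_max (F s + F s^T)] pays for. *)
Lemma ctrl_lmi p m (A H : R -> 'M[R]_p) (B : R -> 'M[R]_(p, m))
    (Z : 'M[R]_p) (W : 'M[R]_(m, p)) (D : 'M[R]_p) a b h (s t : R) w :
  let F u := (A u + H u) *m Z + B u *m W + D in
  C1_deriv_bounded A a -> C1_deriv_bounded B b -> C1_deriv_bounded H h ->
  0 <= s -> s <= t ->
  lambda_max (F s + (F s)^T)
    + 2 * (t - s) * ((a + h) * opnorm Z + b * opnorm W) <= 0 ->
  dot w (F t *m w) <= 0.
Proof.
move=> F Aa Bb Hh s0 st lF; rewrite -mulrA in lF. apply: (perturbed_lmi w lF) => v.
have -> : (F t - F s) *m v =
    (A t - A s) *m (Z *m v) + (H t - H s) *m (Z *m v) + (B t - B s) *m (W *m v).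
  by rewrite /F !(mulmxBl, mulmxDl, mulNmx) -!mulmxA subr_sum3.
rewrite !dotDr -enorm_sqr.
have n0 := enorm_ge0 v.
have bnd p' q' (f : R -> 'M[R]_(p', q')) (X : 'M[R]_(q', p)) c (w' : 'cV_p') :
    C1_deriv_bounded f c -> enorm w' = enorm v ->
    dot w' ((f t - f s) *m (X *m v)) <= (t - s) * (c * opnorm X) * enorm v ^+ 2.
  move=> fc w'v; apply: le_trans (ler_norm _) _; apply: le_trans (cauchy_schwarz _ _) _.
  have h1 := C1_increment_norm (X *m v) fc s0 st.
  have h2 := enorm_opnorm X v; have c0 := C1_bound_ge0 fc.
  have ts : 0 <= t - s by rewrite subr_ge0.
  rewrite w'v; apply: le_trans (ler_wpM2l n0 h1) _.
  have := ler_wpM2l (mulr_ge0 (mulr_ge0 n0 c0) ts) h2; lra.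
have hA := bnd _ _ _ Z _ v Aa erefl.
have hH := bnd _ _ _ Z _ v Hh erefl.
have hB := bnd _ _ _ W _ v Bb erefl.
by rewrite !mulrDl !mulrDr !mulrDl; lra.
Qed.

Lemma obs_lmi p r (A H : R -> 'M[R]_p) (C : R -> 'M[R]_(r, p))
    (P : 'M[R]_p) (W : 'M[R]_(p, r)) (D : 'M[R]_p) a c h (s t : R) w :
  let F u := P *m (A u + H u) + W *m C u + D in
  C1_deriv_bounded A a -> C1_deriv_bounded C c -> C1_deriv_bounded H h ->
  0 <= s -> s <= t ->
  lambda_max (F s + (F s)^T)
    + 2 * (t - s) * ((a + h) * opnorm P + c * opnorm W) <= 0 ->
  dot w (F t *m w) <= 0.
Proof.
move=> F Aa Cc Hh s0 st lF; rewrite -mulrA in lF; apply: (perturbed_lmi w lF) => v.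
have -> : (F t - F s) *m v =
    P *m ((A t - A s) *m v) + P *m ((H t - H s) *m v) + W *m ((C t - C s) *m v).
  rewrite !mulmxA -!mulmxDl; congr (_ *m _).
  by rewrite /F !(mulmxBr, mulmxDr, mulmxN) subr_sum3.
rewrite !dotDr -enorm_sqr.
have n0 := enorm_ge0 v.
have bnd q' (f : R -> 'M[R]_(q', p)) (X : 'M[R]_(p, q')) k :
    C1_deriv_bounded f k ->
    dot v (X *m ((f t - f s) *m v)) <= (t - s) * (k * opnorm X) * enorm v ^+ 2.
  move=> fk; apply: le_trans (ler_norm _) _; apply: le_trans (dot_opnorm _ _ _) _.
  have h1 := C1_increment_norm v fk s0 st.
  by have := ler_wpM2l (mulr_ge0 (opnorm_ge0 X) n0) h1; lra.
have hA := bnd _ _ P _ Aa.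
have hH := bnd _ _ P _ Hh.
have hC := bnd _ _ W _ Cc.
by rewrite !mulrDl !mulrDr !mulrDl; lra.
Qed.
End Lyapunov.

(** * Exponential decay of the stacked closed loop *)

Section Inverse.
Variable R : realType.

Lemma sym_invmx p (Z : 'M[R]_p) : Z^T = Z -> (invmx Z)^T = invmx Z.
Proof. by move=> sZ; rewrite trmx_inv sZ. Qed.

Lemma dot_invmx p (Z : 'M[R]_p) x : pdmx Z ->
  dot x (invmx Z *m x) = dot (invmx Z *m x) (Z *m (invmx Z *m x)).
Proof. by move=> pZ; rewrite mulKVmx ?pdmx_unit// dotC. Qed.

(** With [Z w = Z' w' = x], expand [0 <= (w - w')^T Z (w - w')] and bound
    [w'^T Z w'] by [w'^T Z' w']. *)
Lemma invmx_form_antitone p (Z Z' : 'M[R]_p) x : pdmx Z -> pdmx Z' ->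
  psdmx (Z' - Z) -> dot x (invmx Z' *m x) <= dot x (invmx Z *m x).
Proof.
move=> pZ pZ' dZ; have uZ := pdmx_unit pZ; have uZ' := pdmx_unit pZ'.
set w := invmx Z *m x; set w' := invmx Z' *m x.
have Zw : Z *m w = x by rewrite mulKVmx.
have Zw' : Z' *m w' = x by rewrite mulKVmx.
have [sZ _] := pZ.
have h1 : 0 <= dot (w - w') (Z *m (w - w')).
  have [->|n0] := eqVneq (w - w') 0; first by rewrite mulmx0 dot0r.
  by rewrite -mulmx_dot; apply: ltW; case: pZ => _; apply.
have h2 := psdmx_dot w' dZ; move: h1 h2.
rewrite mulmxBr mulmxBl Zw Zw' !(dotDl, dotDr, dotNl, dotNr).
rewrite [dot w (Z *m w')](dot_swap _ _ sZ) Zw ![dot w x]dotC ![dot w' x]dotC; lra.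
Qed.

(** Expand [0 <= (w - x / c)^T Z (w - x / c)] with [w = Z^-1 x]. *)
Lemma invmx_form_ge p (Z : 'M[R]_p) c x : pdmx Z -> 0 < c ->
  (forall y, dot y (Z *m y) <= c * dot y y) ->
  c^-1 * dot x x <= dot x (invmx Z *m x).
Proof.
move=> pZ c0 Zc; have uZ := pdmx_unit pZ; have [sZ _] := pZ.
set w := invmx Z *m x; have Zw : Z *m w = x by rewrite mulKVmx.
have h : 0 <= dot (w - c^-1 *: x) (Z *m (w - c^-1 *: x)).
  have [->|n0] := eqVneq (w - c^-1 *: x) 0; first by rewrite mulmx0 dot0r.
  by rewrite -mulmx_dot; apply: ltW; case: pZ => _; apply.
move: h; rewrite mulmxBr Zw -scalemxAr !(dotDl, dotDr, dotNl, dotNr, dotZl, dotZr).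
rewrite [dot w (Z *m x)](dot_swap _ _ sZ) Zw [dot w x]dotC.
have /(ler_wpM2l (_ : 0 <= c^-1 ^+ 2)) := Zc x; rewrite sqr_ge0 => /(_ isT).
have -> : c^-1 ^+ 2 * (c * dot x x) = c^-1 * dot x x by field; rewrite gt_eqF.
lra.
Qed.
End Inverse.

(** The setting is a linear system with a triangular structure (the error drives the
    state), whose matrices satisfy the inequalities [lmi] and [lmih] throughout each
    step.  [D] and [Dh] stand for [beta o Z] and [beta o P], which dominate [alpha Z] and
    [alpha P].  Conditions on step [k] are required only when the
    step is reached, i.e. [t k < +oo]. *)
Section StackedDecay.
Variables (R : realType) (p m r : nat).
Variables (A H : R -> 'M[R]_p) (B : R -> 'M[R]_(p, m)) (C : R -> 'M[R]_(r, p)).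
Variables (Z P D Dh : nat -> 'M[R]_p) (W : nat -> 'M[R]_(m, p)).
Variables (Wh : nat -> 'M[R]_(p, r)) (t : nat -> \bar R).
Variables (alpha c1 delta cK b : R).
Hypothesis alpha_gt0 : 0 < alpha.
Hypothesis c1_gt0 : 0 < c1.
Hypothesis delta_gt0 : 0 < delta.
Hypothesis B_C1 : C1_deriv_bounded B b.
Hypothesis t0 : t 0%N = 0%E.
Hypothesis t_mono : forall k, (t k <= t k.+1)%E.
Hypothesis t_cover : forall tau : R, 0 <= tau ->
  exists k, (t k <= tau%:E)%E /\ (tau%:E < t k.+1)%E.
Hypothesis Z_pd : forall k, (t k < +oo)%E -> pdmx (Z k).
Hypothesis Z_le : forall k x, (t k < +oo)%E -> dot x (Z k *m x) <= c1 * dot x x.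
Hypothesis P_sym : forall k, (t k < +oo)%E -> (P k)^T = P k.
Hypothesis P_ge : forall k x, (t k < +oo)%E ->
  delta * dot x x <= dot x (P k *m x).
Hypothesis ZP_mono : forall k, (t k.+1 < +oo)%E ->
  psdmx (Z k.+1 - Z k) /\ psdmx (P k - P k.+1).
Hypothesis gain_le : forall k x, (t k < +oo)%E ->
  enorm (W k *m invmx (Z k) *m x) <= cK * enorm x.
Hypothesis D_ge : forall k w, (t k < +oo)%E ->
  alpha * dot w (Z k *m w) <= dot w (D k *m w).
Hypothesis Dh_ge : forall k w, (t k < +oo)%E ->
  alpha * dot w (P k *m w) <= dot w (Dh k *m w).
Hypothesis lmi : forall k tau w, (t k <= tau%:E)%E -> (tau%:E < t k.+1)%E ->
  dot w (((A tau + H tau) *m Z k + B tau *m W k + D k) *m w) <= 0.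
Hypothesis lmih : forall k tau w, (t k <= tau%:E)%E -> (tau%:E < t k.+1)%E ->
  dot w ((P k *m (A tau + H tau) + Wh k *m C tau + Dh k) *m w) <= 0.

Let V k x := dot x (invmx (Z k) *m x).
Let Vh k e := dot e (P k *m e).

Let t_nd k l : (k <= l)%N -> (t k <= t l)%E.
Proof.
elim: l => [|l IH]; first by rewrite leqn0 => /eqP ->.
rewrite leq_eqVlt => /predU1P[->//|/IH h]; exact: le_trans h (t_mono l).
Qed.

Let t_ge0 k : (0 <= t k)%E. Proof. by rewrite -t0; exact: t_nd. Qed.

Let act_pred k : (t k.+1 < +oo)%E -> (t k < +oo)%E.
Proof. exact: le_lt_trans. Qed.

Let V_ge k x : (t k < +oo)%E -> c1^-1 * dot x x <= V k x.
Proof. by move=> tk; apply: invmx_form_ge => [|//|y]; [exact: Z_pd | exact: Z_le]. Qed.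

Let Vh_ge0 k x : (t k < +oo)%E -> 0 <= Vh k x.
Proof.
by move=> tk; apply: le_trans (P_ge x tk); rewrite mulr_ge0 ?dot_ge0// ltW.
Qed.

Let V_dec k x : (t k.+1 < +oo)%E -> V k.+1 x <= V k x.
Proof.
move=> tk; apply: invmx_form_antitone; [apply/Z_pd/act_pred|apply: Z_pd|] => //.
by case: (ZP_mono tk).
Qed.

Let Vh_dec k x : (t k.+1 < +oo)%E -> Vh k.+1 x <= Vh k x.
Proof.
move=> tk; have [_ /(psdmx_dot x)] := ZP_mono tk.
by rewrite mulmxBl dotDr dotNr subr_ge0.
Qed.

Let V_dec0 k x : (t k < +oo)%E -> V k x <= V 0 x.
Proof. by elim: k => // k IH tk; apply: le_trans (V_dec x tk) _; exact/IH/act_pred. Qed.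

Let Vh_dec0 k x : (t k < +oo)%E -> Vh k x <= Vh 0 x.
Proof. by elim: k => // k IH tk; apply: le_trans (Vh_dec x tk) _; exact/IH/act_pred. Qed.

Let Z_ge0 k x : (t k < +oo)%E -> dot x (Z 0 *m x) <= dot x (Z k *m x).
Proof.
elim: k => // k IH tk; apply: le_trans (IH (act_pred tk)) _.
have [/(psdmx_dot x) + _] := ZP_mono tk.
by rewrite mulmxBl dotDr dotNr subr_ge0.
Qed.

(** The bound on [B tau] provided by [C1_growth]. *)
Let q (tau : R) := opnorm (B 0) + b * tau.

Let dx k tau (x e : 'cV[R]_p) : 'cV[R]_p :=
  (A tau + H tau) *m x + B tau *m (W k *m (invmx (Z k) *m (x + e))).
Let de k tau (e : 'cV[R]_p) : 'cV[R]_p :=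
  (A tau + H tau) *m e + invmx (P k) *m (Wh k *m (C tau *m e)).

Let P_unit k : (t k < +oo)%E -> P k \in unitmx.
Proof. by move=> tk; apply: coercive_unitmx delta_gt0 _ => x; exact: P_ge. Qed.

Let Vh_deriv k tau e : (t k <= tau%:E)%E -> (tau%:E < t k.+1)%E ->
  2 * dot (P k *m e) (de k tau e) <= - (2 * alpha) * Vh k e.
Proof.
move=> h1 h2; have tk : (t k < +oo)%E by apply: le_lt_trans h1 _; exact: ltry.
have := lmih e h1 h2; have := Dh_ge e tk.
rewrite dotMl (P_sym tk) /de mulmxDr mulKVmx ?P_unit//.
by rewrite !mulmxDl -!mulmxA !dotDr -/(Vh k e) !mulmxDl !mulmxDr !dotDr; lra.
Qed.

(** In the variable [w = Z^-1 x] the inequality [lmi] bounds the derivative by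
    [- 2 alpha V + 2 w^T B K e].  Young's inequality trades half of the decay rate for
    the coupling, using [l |w|^2 <= w^T Z 0 w <= w^T Z k w = V]: since [Z] grows with
    [k], the constant [l] taken from [Z 0] serves for all steps. *)
Let V_deriv : exists2 kap : R, 0 <= kap & forall k (tau : R) x e, 0 <= tau ->
    (t k <= tau%:E)%E -> (tau%:E < t k.+1)%E ->
  2 * dot (invmx (Z k) *m x) (dx k tau x e) <=
    - alpha * V k x + kap * q tau ^+ 2 * Vh k e.
Proof.
have a0 : (t 0%N < +oo)%E by rewrite t0 ltry.
have [l l0 lZ] := pdmx_coercive (Z_pd a0).
exists (cK ^+ 2 / (alpha * l) / delta) => [|k tau x e tau0 h1 h2].
  by rewrite !divr_ge0 ?sqr_ge0 ?mulr_ge0// ltW.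
have tk : (t k < +oo)%E by apply: le_lt_trans h1 _; exact: ltry.
have uZ := pdmx_unit (Z_pd tk).
set w := invmx (Z k) *m x.
have xw : x = Z k *m w by rewrite mulKVmx.
have Vw : V k x = dot w (Z k *m w) by rewrite /V dot_invmx//; exact: Z_pd.
have hD := D_ge w tk; have hl := lmi w h1 h2.
have hw : l * enorm w ^+ 2 <= V k x.
  by rewrite enorm_sqr Vw; apply: le_trans (lZ w) _; exact: Z_ge0.
have he : delta * enorm e ^+ 2 <= Vh k e by rewrite enorm_sqr; exact: P_ge.
have hB : dot w (B tau *m (W k *m (invmx (Z k) *m e))) <= q tau * (enorm w * (cK * enorm e)).
  apply: le_trans (C1_growth _ _ B_C1 tau0) _.
  rewrite ler_wpM2l ?ler_wpM2l ?enorm_ge0//; last by rewrite mulmxA gain_le.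
  by rewrite addr_ge0 ?opnorm_ge0// mulr_ge0// (C1_bound_ge0 B_C1).
have -> : dot w (dx k tau x e) =
    dot w ((A tau + H tau) *m (Z k *m w)) + dot w (B tau *m (W k *m w)) +
    dot w (B tau *m (W k *m (invmx (Z k) *m e))).
  by rewrite /dx mulmxDr -/w !mulmxDr !dotDr -xw addrA.
have {}hl : dot w ((A tau + H tau) *m (Z k *m w)) + dot w (B tau *m (W k *m w)) <= - alpha * V k x.
  by move: hl hD; rewrite !mulmxDl -!mulmxA !dotDr Vw; lra.
set Q := q tau; set X := enorm w; set Y := enorm e.
rewrite -/Q -/X -/Y in hB hw he.
have al0 : 0 < alpha * l by rewrite mulr_gt0.
have h3 : 2 * (Q * (X * (cK * Y))) <=
    alpha * l * X ^+ 2 + (cK ^+ 2 / (alpha * l)) * Q ^+ 2 * Y ^+ 2.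
  rewrite -subr_ge0; have -> : alpha * l * X ^+ 2 + (cK ^+ 2 / (alpha * l)) * Q ^+ 2 * Y ^+ 2 -
      2 * (Q * (X * (cK * Y))) = (alpha * l * X - Q * cK * Y) ^+ 2 / (alpha * l).
    by field; rewrite !gt_eqF.
  by rewrite divr_ge0 ?sqr_ge0// ltW.
have h4 : (cK ^+ 2 / (alpha * l)) * Q ^+ 2 * Y ^+ 2 <=
    cK ^+ 2 / (alpha * l) / delta * Q ^+ 2 * Vh k e.
  have -> : cK ^+ 2 / (alpha * l) / delta * Q ^+ 2 * Vh k e =
    (cK ^+ 2 / (alpha * l)) * Q ^+ 2 * (Vh k e / delta) by ring.
  apply: ler_wpM2l; last by rewrite ler_pdivlMr// mulrC.
  by rewrite mulr_ge0 ?sqr_ge0// divr_ge0 ?sqr_ge0// ltW.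
by have := ler_wpM2l (ltW alpha_gt0) hw; lra.
Qed.

Let expR_lin_deriv (c u : R) : is_derive u 1 (fun s => expR (c * s)) (c * expR (c * u)).
Proof.
have h := is_derive_mull c (is_derive_id u (1 : R)); rewrite mulr1 in h.
by rewrite mulrC; exact: is_derive1_comp (is_derive_expR (c * u)) h.
Qed.

(** [1 + y <= exp y] at [y = alpha tau / 4] dominates the affine function [q]; the square
    gives the exponent [alpha tau / 2]. *)
Let q_le (tau : R) : 0 <= tau ->
  q tau ^+ 2 <= (opnorm (B 0) + b * (4 / alpha)) ^+ 2 * expR (alpha / 2 * tau).
Proof.
move=> tau0; have b0 := C1_bound_ge0 B_C1; have B0 := opnorm_ge0 (B 0).
have -> : alpha / 2 * tau = alpha / 4 * tau + alpha / 4 * tau by field.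
have E := expR_ge1Dx (alpha / 4 * tau).
have r4 : 0 <= 4 / alpha by rewrite divr_ge0// ltW.
have Q0 : 0 <= opnorm (B 0) + b * (4 / alpha) by apply: addr_ge0 => //; exact: mulr_ge0.
have at0 : 0 <= alpha / 4 * tau by rewrite mulr_ge0// divr_ge0// ltW.
rewrite expRD -expr2 -exprMn ler_pXn2r// ?nnegrE /q.
- apply: le_trans (_ : _ <= (opnorm (B 0) + b * (4 / alpha)) * (1 + alpha / 4 * tau)) _.
    have -> : (opnorm (B 0) + b * (4 / alpha)) * (1 + alpha / 4 * tau) =
       opnorm (B 0) + b * tau + (opnorm (B 0) * (alpha / 4 * tau) + b * (4 / alpha)).
      by field; rewrite gt_eqF.
    by rewrite lerDl; apply: addr_ge0; exact: mulr_ge0.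
  by rewrite ler_wpM2l.
- by rewrite addr_ge0 ?mulr_ge0.
- by rewrite mulr_ge0 ?expR_ge0.
Qed.

Let form_cvg (F : set_system R) {FF : Filter F} (M : 'M[R]_p) (x : R -> 'cV[R]_p)
    (a : 'cV[R]_p) :
  (forall i, x u i 0 @[u --> F] --> a i 0) ->
  dot (x u) (M *m x u) @[u --> F] --> dot a (M *m a).
Proof. by move=> xa; apply: cvg_dot => // i; exact: cvg_mulmx_entry.
Qed.

Let form_deriv (M : 'M[R]_p) (x : R -> 'cV[R]_p) u d : M^T = M -> vderiv x u d ->
  is_derive u 1 (fun s => dot (x s) (M *m x s)) (2 * dot (M *m x u) d).
Proof.
move=> sM xd; apply: is_derive_eq (is_derive_dot xd (vderiv_mulmx M xd)) _.
by rewrite (dot_swap (x u) d sM) [dot (M *m x u) d]dotC; ring.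
Qed.

(** The function [Phi k] is nonincreasing inside step [k] (by the choice of [G]) and
    [Phi k.+1 <= Phi k], so [Phi k u <= Phi 0 s] for every [k] and every [u >= s] in step
    [k].  Bounding the left side by [PhiL] and the right side by [Phi0] gives the decay.
    Starting from [Phi 0] rather than from the step that contains [s] is legitimate as
    [Phi k s <= Phi 0 s], and makes the induction on [k] uniform. *)
Lemma stacked_decay (s : R) : 0 <= s -> exists2 K : R, 0 < K &
  forall x e : R -> 'cV[R]_p,
  (forall i, {within `[s, +oo[, continuous (fun u => x u i 0)}) ->
  (forall i, {within `[s, +oo[, continuous (fun u => e u i 0)}) ->
  (forall k (u : R), s < u -> (t k < u%:E)%E -> (u%:E < t k.+1)%E ->
     vderiv x u (dx k u (x u) (e u)) /\ vderiv e u (de k u (e u))) ->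
  forall u : R, s <= u ->
    dot (x u) (x u) + dot (e u) (e u) <=
    K * expR (- (alpha * u)) * (dot (x s) (x s) + dot (e s) (e s)).
Proof.
move=> s0; have [kap kap0 Vd] := V_deriv.
pose Q := opnorm (B 0) + b * (4 / alpha).
(* the first summand cancels the coupling term; the second makes G positive even if
   kap = 0 *)
pose G := 2 * kap * Q ^+ 2 / alpha + 1.
have G0 : 0 < G.
  apply: ltr_wpDl => //; apply: divr_ge0; last exact: ltW.
  by apply: mulr_ge0; [exact: mulr_ge0 | exact: sqr_ge0].
pose Phi k u y z := expR (alpha * u) * V k y + G * (expR (3 / 2 * alpha * u) * Vh k z).
have [cx cx0 Vc] := form_bounded (invmx (Z 0)).
have [ce ce0 Vhc] := form_bounded (P 0).
pose K0 := expR (alpha * s) * cx + G * (expR (3 / 2 * alpha * s) * ce).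
have K00 : 0 < K0 by rewrite addr_gt0 ?mulr_gt0 ?expR_gt0.
have Phi0 y z : Phi 0 s y z <= K0 * (dot y y + dot z z).
  have h1 : V 0 y <= cx * dot y y := le_trans (ler_norm _) (Vc y).
  have h2 : Vh 0 z <= ce * dot z z := le_trans (ler_norm _) (Vhc z).
  rewrite /Phi /K0.
  have h3 := ler_wpM2l (expR_ge0 (alpha * s)) h1.
  have h4 := ler_wpM2l (ltW G0) (ler_wpM2l (expR_ge0 (3 / 2 * alpha * s)) h2).
  have h5 := mulr_ge0 (mulr_ge0 (expR_ge0 (alpha * s)) (ltW cx0)) (dot_ge0 z).
  have h6 := mulr_ge0 (ltW G0)
    (mulr_ge0 (mulr_ge0 (expR_ge0 (3 / 2 * alpha * s)) (ltW ce0)) (dot_ge0 y)).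
  lra.
pose L := Num.min c1^-1 (G * delta).
have L0 : 0 < L by rewrite lt_min invr_gt0 c1_gt0 mulr_gt0.
have PhiL k u y z : (t k < +oo)%E -> 0 <= u ->
    expR (alpha * u) * (L * (dot y y + dot z z)) <= Phi k u y z.
  move=> tk u0; rewrite /Phi !mulrDr; apply: lerD.
    rewrite ler_wpM2l ?expR_ge0//; apply: le_trans (V_ge y tk).
    by rewrite ler_wpM2r ?dot_ge0// ge_min lexx.
  have E : expR (alpha * u) <= expR (3 / 2 * alpha * u).
    by rewrite ler_expR; have := mulr_ge0 (ltW alpha_gt0) u0; lra.
  have LG : L <= G * delta by rewrite ge_min lexx orbT.
  have := ler_wpM2r (dot_ge0 z) (ler_pM (expR_ge0 _) (ltW L0) E LG).
  have := ler_wpM2l (mulr_ge0 (ltW G0) (expR_ge0 (3 / 2 * alpha * u))) (P_ge z tk).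
  by rewrite /Vh; lra.
have Phi_dec k y z : (t k.+1 < +oo)%E -> forall u, Phi k.+1 u y z <= Phi k u y z.
  move=> tk u; rewrite /Phi lerD//; first by rewrite ler_wpM2l ?expR_ge0// V_dec.
  by rewrite ler_wpM2l ?(ltW G0)// ler_wpM2l ?expR_ge0// Vh_dec.
have Phi_dec0 k y z : (t k < +oo)%E -> forall u, Phi k u y z <= Phi 0 u y z.
  move=> tk u; rewrite /Phi lerD//; first by rewrite ler_wpM2l ?expR_ge0// V_dec0.
  by rewrite ler_wpM2l ?(ltW G0)// ler_wpM2l ?expR_ge0// Vh_dec0.
exists (K0 / L) => [|x e cx' ce' sol]; first by rewrite divr_gt0.
have seg k u v : (t k < +oo)%E -> s <= u -> u <= v -> (t k <= u%:E)%E -> (v%:E <= t k.+1)%E ->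
    Phi k v (x v) (e v) <= Phi k u (x u) (e u).
  move=> tk su uv tu vt.
  have [sZ _] := Z_pd tk; have sP := P_sym tk.
  pose dPhi w := (alpha * expR (alpha * w) * V k (x w) +
    expR (alpha * w) * (2 * dot (invmx (Z k) *m x w) (dx k w (x w) (e w)))) +
    G * (3 / 2 * alpha * expR (3 / 2 * alpha * w) * Vh k (e w) +
    expR (3 / 2 * alpha * w) * (2 * dot (P k *m e w) (de k w (e w)))).
  have sub y : y \in `[u, v] -> `[s, +oo[%classic y.
    by rewrite /= !in_itv/= andbT => /andP[uy _]; exact: le_trans uy.
  have cont (y : R -> 'cV[R]_p) (M : 'M[R]_p) :
      (forall i, {within `[s, +oo[, continuous (fun w => y w i 0)}) ->
      {within `[u, v], continuous (fun w => dot (y w) (M *m y w))}.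
    move=> cy w.
    have {}cy i : {within `[u, v], continuous (fun w => y w i 0)}.
      by apply: continuous_subspaceW (cy i) => ? /sub.
    apply: form_cvg; [exact: nbhs_subspace_filter | move=> i; exact: cy].
  have cexp (c : R) : {within `[u, v], continuous (fun w => expR (c * w))}.
    apply: continuous_subspaceT => w; apply: differentiable_continuous.
    by apply/derivable1_diffP; case: (expR_lin_deriv c w).
  have inside w : u < w < v -> [/\ s < w, (t k < w%:E)%E & (w%:E < t k.+1)%E].
    move=> /andP[uw wv]; split; first exact: le_lt_trans uw.
      by apply: le_lt_trans tu _; rewrite lte_fin.
    by apply: lt_le_trans vt; rewrite lte_fin.
  apply: (@nonincreasing_segment _ (fun w => Phi k w (x w) (e w)) dPhi u v) => //.
  - move=> w; apply: cvgD.
      by apply: cvgM; [exact: cexp | exact: cont].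
    apply: cvgM; first exact: cvg_cst.
    by apply: cvgM; [exact: cexp | exact: cont].
  - move=> w /inside[sw tw wt]; have [xd ed] := sol k w sw tw wt.
    apply: is_deriveD.
      apply: is_derive_mulr (expR_lin_deriv _ _) _.
      by apply: form_deriv xd; exact: sym_invmx.
    apply: is_derive_mull; apply: is_derive_mulr (expR_lin_deriv _ _) _.
    exact: form_deriv ed.
  - move=> w /inside[sw tw wt]; have w0 : 0 <= w by apply: le_trans s0 (ltW sw).
    have h1 := Vd k w (x w) (e w) w0 (ltW tw) wt.
    have h2 := Vh_deriv (e w) (ltW tw) wt.
    have h3 := q_le w0; rewrite -/Q in h3.
    have vh0 := Vh_ge0 (e w) tk.
    have E3 : expR (3 / 2 * alpha * w) = expR (alpha * w) * expR (alpha / 2 * w).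
      by rewrite -expRD; congr expR; field.
    rewrite /dPhi E3.
    have e1 := expR_ge0 (alpha * w); have e2 := expR_ge0 (alpha / 2 * w).
    set e1' := expR (alpha * w) in e1 *; set e2' := expR (alpha / 2 * w) in e2 h3 *.
    have h1' := ler_wpM2l e1 h1.
    have h2' := ler_wpM2l (mulr_ge0 (ltW G0) (mulr_ge0 e1 e2)) h2.
    have h3' := ler_wpM2l (mulr_ge0 (mulr_ge0 e1 kap0) vh0) h3.
    have h4 : e1' * kap * Vh k (e w) * (Q ^+ 2 * e2') <= G * alpha / 2 * (e1' * e2' * Vh k (e w)).
      have -> : G * alpha / 2 = kap * Q ^+ 2 + alpha / 2 by rewrite /G; field; rewrite gt_eqF.
      have := mulr_ge0 (ltW alpha_gt0) (mulr_ge0 (mulr_ge0 e1 e2) vh0); lra.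
    by lra.
(* chaining the steps: when t k.+1 > s the trajectory crosses the switching instant,
   where continuity of x and e lets the bound pass from step k to step k.+1 *)
have claim k : (t k < +oo)%E -> forall u, s <= u -> (t k <= u%:E)%E -> (u%:E <= t k.+1)%E ->
    Phi k u (x u) (e u) <= Phi 0 s (x s) (e s).
  elim: k => [|k IH] tk u su tu ut.
    by apply: seg; rewrite // t0 lee_fin.
  have [ts|ts] := leP (t k.+1) s%:E.
    by apply: le_trans (seg _ _ _ tk _ su ts ut) _; rewrite ?Phi_dec0.
  have [v tv] : exists v, t k.+1 = v%:E.
    by exists (fine (t k.+1)); rewrite fineK// ge0_fin_numE.
  rewrite tv lte_fin in ts; rewrite tv lee_fin in tu.
  apply: le_trans (seg _ _ _ tk (ltW ts) tu _ ut) _; first by rewrite tv.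
  apply: le_trans (Phi_dec _ _ _ tk _) _.
  by apply: IH; rewrite ?(act_pred tk) ?(ltW ts) -?tv.
move=> u su; have u0 := le_trans s0 su.
have [k [tu ut]] := t_cover u0.
have tk : (t k < +oo)%E by apply: le_lt_trans tu _; exact: ltry.
have h1 := claim k tk u su tu (ltW ut).
have h2 := le_trans (PhiL k u _ _ tk u0) (le_trans h1 (Phi0 _ _)).
rewrite expRN; have E0 := expR_gt0 (alpha * u).
set E := expR (alpha * u) in E0 h2 *; set S0 := dot (x s) (x s) + dot (e s) (e s) in h2 *.
have -> : K0 / L / E * S0 = K0 * S0 / (E * L) by field; rewrite !gt_eqF.
by rewrite ler_pdivlMr ?mulr_gt0//; lra.
Qed.
End StackedDecay.

(** * Block matrices *)

Section Norms.
Variable R : realType.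

Lemma enormD p (x y : 'cV[R]_p) : enorm (x + y) <= enorm x + enorm y.
Proof.
rewrite -(@ler_pXn2r _ 2)// ?nnegrE ?addr_ge0 ?enorm_ge0//.
rewrite sqrrD !enorm_sqr !(dotDl, dotDr) [dot y x]dotC.
have := le_trans (ler_norm _) (cauchy_schwarz x y); lra.
Qed.

Lemma enorm_sum p (I : Type) (r : seq I) (P : pred I) (f : I -> 'cV[R]_p) :
  enorm (\sum_(i <- r | P i) f i) <= \sum_(i <- r | P i) enorm (f i).
Proof.
elim/big_ind2 : _ => [|x a y b xa yb|//]; first by rewrite enorm0.
by apply: le_trans (enormD _ _) _; exact: lerD.
Qed.

Lemma sum_sqr_le (I : finType) (a : I -> R) : (forall i, 0 <= a i) ->
  \sum_i a i ^+ 2 <= (\sum_i a i) ^+ 2.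
Proof.
move=> a0; rewrite expr2 mulr_suml; apply: ler_sum => i _.
by rewrite expr2 ler_wpM2l// (bigD1 i)//= lerDl sumr_ge0.
Qed.

Lemma pos_lower_bound N (f : 'I_N -> R) : (forall i, 0 < f i) ->
  exists2 a, 0 < a & forall i, a <= f i.
Proof.
move=> f0; exists (\big[Num.min/1]_i f i).
  by elim/big_ind: _ => // x y x0 y0; rewrite lt_min x0.
by move=> i; exact: bigmin_le.
Qed.
End Norms.

Section Blocks.
Variables (R : realType) (N : nat).
Implicit Types n m : 'I_N -> nat.

Lemma dot_mxcol n (x y : forall i, 'cV[R]_(n i)) :
  dot (\mxcol_i x i) (\mxcol_i y i) = \sum_i dot (x i) (y i).
Proof. by rewrite /dot tr_mxcol mul_mxrow_mxcol summxE. Qed.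

Lemma dot_mxdiag n (D : forall i, 'M[R]_(n i)) (x : forall i, 'cV[R]_(n i)) :
  dot (\mxcol_i x i) (\mxdiag_i D i *m \mxcol_i x i) =
  \sum_i dot (x i) (D i *m x i).
Proof. by rewrite mul_mxdiag_mxcol dot_mxcol. Qed.

Lemma mul_blockdiag_mxcol n m (D : forall i, 'M[R]_(n i, m i))
    (x : forall i, 'cV[R]_(m i)) :
  blockdiag D *m \mxcol_i x i = \mxcol_i (D i *m x i).
Proof.
rewrite /blockdiag mul_mxblock_mxrow; apply/eq_mxcol => i.
rewrite (bigD1 i)//= eqxx conform_mx_id big1 ?addr0// => j.
by rewrite eq_sym; case: eqVneq => //= _ _; rewrite mul0mx.
Qed.

(** Interconnection terms: with [F i i = 0] the full block product is the sum over
    [j != i].  As [mxdiag] is convertible to [blockdiag] for square blocks, this also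
    applies to [A + H]. *)
Lemma mul_block_mxcol n m (D : forall i, 'M[R]_(n i, m i))
    (F : forall i j, 'M[R]_(n i, m j)) (x : forall i, 'cV[R]_(m i)) :
  (forall i, F i i = 0) ->
  (blockdiag D + \mxblock_(i, j) F i j) *m \mxcol_i x i =
  \mxcol_i (D i *m x i + \sum_(j | j != i) F i j *m x j).
Proof.
move=> F0; rewrite mulmxDl mul_blockdiag_mxcol mul_mxblock_mxrow -mxcolD.
apply/eq_mxcol => i; congr (_ + _).
by rewrite (bigD1 i)//= F0 mul0mx add0r.
Qed.

Lemma hadamard_mxdiag n (beta : 'I_N -> R) (Z : forall i, 'M[R]_(n i)) :
  hadamard (beta_mx n beta) (\mxdiag_i Z i) = \mxdiag_i (beta i *: Z i).
Proof.
apply/matrixP => k l; rewrite !mxE.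
move: (tagnat.sig2 l); case: eqVneq => [<-|_] v; rewrite ?conform_mx_id !mxE//.
by rewrite mul0r.
Qed.

Lemma hadamard_form_ge n (beta : 'I_N -> R) (Z : forall i, 'M[R]_(n i)) a w :
  (forall i, a <= beta i) -> (forall i x, 0 <= dot x (Z i *m x)) ->
  a * dot w (\mxdiag_i Z i *m w) <= dot w (hadamard (beta_mx n beta) (\mxdiag_i Z i) *m w).
Proof.
move=> ab Z0; rewrite hadamard_mxdiag -(submxcolK w) !dot_mxdiag mulr_sumr.
apply: ler_sum => i _; rewrite -scalemxAl dotZr.
by rewrite ler_wpM2r.
Qed.

(** Embedding of a block, used to restrict a quadratic form to a diagonal block. *)
Definition block_vec n i (v : 'cV[R]_(n i)) : 'cV[R]_(\sum_i n i) :=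
  \mxcol_j dfwith (fun j => 0 : 'cV[R]_(n j)) i v j.

Lemma dot_block_vec n (D : forall i, 'M[R]_(n i)) i (v : 'cV[R]_(n i)) :
  dot (block_vec v) (\mxdiag_i D i *m block_vec v) = dot v (D i *m v).
Proof.
rewrite dot_mxdiag (bigD1 i)//= dfwithin big1 ?addr0// => j ji.
by rewrite dfwithout ?mulmx0 ?dot0r// eq_sym.
Qed.

Lemma pdmx_block n (D : forall i, 'M[R]_(n i)) i :
  (D i)^T = D i -> pdmx (\mxdiag_i D i) -> pdmx (D i).
Proof.
move=> sD [_ pD]; split=> // v v0; rewrite mulmx_dot -dot_block_vec -mulmx_dot.
apply: pD; apply: contra v0 => /eqP v0; apply/eqP.
have := congr1 (fun x => submxcol x i) v0.
by rewrite /block_vec mxcolK dfwithin submxcol0.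
Qed.

Lemma mul_invmx_mxdiag n (Z : forall i, 'M[R]_(n i)) (x : forall i, 'cV[R]_(n i)) :
  \mxdiag_i Z i \in unitmx -> (forall i, Z i \in unitmx) ->
  invmx (\mxdiag_i Z i) *m \mxcol_i x i = \mxcol_i (invmx (Z i) *m x i).
Proof.
move=> uD uZ; apply: (can_inj (mulKmx uD)); rewrite mulKVmx// mul_mxdiag_mxcol.
by apply/eq_mxcol => i; rewrite mulKVmx.
Qed.

Lemma enorm_block n (x : forall i, 'cV[R]_(n i)) i :
  enorm (x i) <= enorm (\mxcol_i x i).
Proof.
rewrite !enormE ler_wsqrtr// dot_mxcol (bigD1 i)//= lerDl.
by rewrite sumr_ge0// => j _; exact: dot_ge0.
Qed.

Lemma enorm_mxcol_le n (x : forall i, 'cV[R]_(n i)) (c : 'I_N -> R) a :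
  0 <= a -> (forall i, 0 <= c i) -> (forall i, enorm (x i) <= c i * a) ->
  enorm (\mxcol_i x i) <= (\sum_i c i) * a.
Proof.
move=> a0 c0 xc; have S0 : 0 <= \sum_i c i by exact: sumr_ge0.
rewrite -(@ler_pXn2r _ 2)// ?nnegrE ?mulr_ge0 ?enorm_ge0//.
rewrite enorm_sqr dot_mxcol mulr_suml.
apply: le_trans (sum_sqr_le (fun i => mulr_ge0 (c0 i) a0)).
apply: ler_sum => i _; rewrite -enorm_sqr ler_pXn2r// ?nnegrE ?mulr_ge0 ?enorm_ge0//.
Qed.

(** Bounds on the blocks of [K = (W + Y) Z^-1] yield a bound on [K] that only depends
    on the design bounds, hence is the same for all steps. *)
Lemma stacked_gain_bound n m (Z : forall i, 'M[R]_(n i))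
    (W : forall i, 'M[R]_(m i, n i)) (Y : forall i j, 'M[R]_(m i, n j))
    (kappa : 'I_N -> R) (iota : 'I_N -> 'I_N -> R) x :
  \mxdiag_i Z i \in unitmx -> (forall i, Z i \in unitmx) ->
  (forall i, Y i i = 0) ->
  (forall i, 0 <= kappa i) -> (forall i j, 0 <= iota i j) ->
  (forall i, opnorm (W i *m invmx (Z i)) <= kappa i) ->
  (forall i j, opnorm (Y i j *m invmx (Z j)) <= iota i j) ->
  enorm ((blockdiag W + \mxblock_(i, j) Y i j) *m invmx (\mxdiag_i Z i) *m x) <=
  (\sum_i (kappa i + \sum_j iota i j)) * enorm x.
Proof.
move=> uD uZ Y0 k0 i0 Wk Yi.
rewrite -mulmxA -{1}(submxcolK x) mul_invmx_mxdiag// mul_block_mxcol//.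
have xi i : enorm (submxcol x i) <= enorm x.
  by rewrite -{2}(submxcolK x); exact: enorm_block.
apply: enorm_mxcol_le => [|i|i]; first exact: enorm_ge0.
  by rewrite addr_ge0// sumr_ge0.
rewrite mulrDl; apply: le_trans (enormD _ _) _; apply: lerD.
  rewrite mulmxA; apply: le_trans (enorm_opnorm _ _) _.
  by apply: ler_pM; rewrite ?opnorm_ge0 ?enorm_ge0.
apply: le_trans (enorm_sum _ _ _) _; rewrite mulr_suml.
rewrite [leRHS](bigID (fun j => j != i))/= -[leLHS]addr0 lerD//; last first.
  by rewrite sumr_ge0// => j _; rewrite mulr_ge0 ?enorm_ge0.
apply: ler_sum => j _; rewrite mulmxA; apply: le_trans (enorm_opnorm _ _) _.
by apply: ler_pM; rewrite ?opnorm_ge0 ?enorm_ge0.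
Qed.

Lemma mxdiag_scalar_ge n (eps : 'I_N -> R) a (x : 'cV[R]_(\sum_i n i)) :
  (forall i, a <= eps i) ->
  a * dot x x <= dot x (\mxdiag_i ((eps i)%:M : 'M[R]_(n i)) *m x).
Proof.
move=> ae; rewrite -(submxcolK x) dot_mxdiag dot_mxcol mulr_sumr.
by apply: ler_sum => i _; rewrite mul_scalar_mx dotZr ler_wpM2r ?dot_ge0.
Qed.
End Blocks.

(** * Switching times *)

Section Switching.
Variable R : realType.

(** When a denominator is 0 the extended quotient is [+oo] or 0, and the product on the
    left of the conclusion vanishes, so no case is lost. *)
Lemma half_mine_quotient (x y D E d : R) : 0 <= x -> 0 <= y -> 0 <= D -> 0 <= E ->
  (d%:E < (2^-1)%:E * mine (x%:E / D%:E) (y%:E / E%:E))%E ->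
  2 * d * D <= x /\ 2 * d * E <= y.
Proof.
have half (a b : R) (u : \bar R) : 0 <= a -> 0 <= b -> (u <= a%:E / b%:E)%E ->
    (d%:E < (2^-1)%:E * u)%E -> 2 * d * b <= a.
  move=> a0; rewrite le_eqVlt => /predU1P[<-|b0] ub du; first by rewrite mulr0.
  have : (d%:E < (2^-1)%:E * (a%:E / b%:E))%E.
    by apply: lt_le_trans du _; rewrite lee_pmul2l// lte_fin invr_gt0.
  rewrite inver gt_eqF// -!EFinM lte_fin mulrA ltr_pdivlMr//; lra.
move=> x0 y0 D0 E0 h; split; [apply: half h | apply: half h] => //.
  by rewrite ge_min lexx.
by rewrite ge_min lexx orbT.
Qed.

Section Sequence.
Variables (t T : nat -> \bar R) (Tmin : R).
Hypothesis t0 : t 0%N = 0%E.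
Hypothesis tS : forall k, (t k < +oo)%E -> t k.+1 = (t k + T k)%E.
Hypothesis tS_oo : forall k, t k = +oo%E -> t k.+1 = +oo%E.
Hypothesis Tmin_gt0 : 0 < Tmin.
Hypothesis T_ge : forall k, (t k < +oo)%E -> (Tmin%:E <= T k)%E.

Lemma switching_step k : (t k + Tmin%:E <= t k.+1)%E.
Proof.
have [tk|] := ltP (t k) +oo%E; first by rewrite tS// leeD2l// T_ge.
by rewrite leye_eq => /eqP tk; rewrite tS_oo// leey.
Qed.

Lemma switching_nd k : (t k <= t k.+1)%E.
Proof. by apply: le_trans (switching_step k); rewrite leeDl// lee_fin ltW. Qed.

Lemma switching_ge0 k : (0 <= t k)%E.
Proof. by elim: k => [|k IH]; rewrite ?t0// (le_trans IH)// switching_nd. Qed.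

Lemma switching_growth k : ((Tmin *+ k)%:E <= t k)%E.
Proof.
elim: k => [|k IH]; first by rewrite mulr0n t0.
by apply: le_trans (switching_step k); rewrite mulrSr EFinD leeD2r.
Qed.

(** Dwell times at least [Tmin] exclude accumulation of switching instants. *)
Lemma switching_cover (tau : R) : 0 <= tau ->
  exists k, (t k <= tau%:E)%E /\ (tau%:E < t k.+1)%E.
Proof.
move=> tau0.
have ex : exists k, (tau%:E < t k.+1)%E.
  exists (Num.truncn (tau / Tmin)); apply: lt_le_trans (switching_growth _).
  by rewrite lte_fin -mulr_natl -ltr_pdivrMr// truncnS_gt.
exists (ex_minn ex); case: ex_minnP => k tk kmin; split=> //.
case: k tk kmin => [|k] tk kmin; first by rewrite t0 lee_fin.
by rewrite leNgt; apply/negP => /kmin; rewrite ltnn.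
Qed.

Lemma switching_apart k (tau : R) : (t k < tau%:E)%E -> (tau%:E < t k.+1)%E ->
  ~ exists l, t l = tau%:E.
Proof.
move=> h1 h2 [l tl].
have nd i j : (i <= j)%N -> (t i <= t j)%E.
  elim: j => [|j IH]; first by rewrite leqn0 => /eqP ->.
  rewrite leq_eqVlt => /predU1P[->//|/IH h]; exact: le_trans h (switching_nd j).
have [/nd|/nd] := leqP l k; rewrite tl.
  by rewrite leNgt h1.
by rewrite leNgt h2.
Qed.

Lemma switching_fin k : (t k < +oo)%E -> t k = (fine (t k))%:E.
Proof. by move=> tk; rewrite fineK// ge0_fin_numE// switching_ge0. Qed.

Lemma switching_elapsed k (tau : R) : (t k <= tau%:E)%E -> (tau%:E < t k.+1)%E ->
  [/\ 0 <= fine (t k), fine (t k) <= tau & ((tau - fine (t k))%:E < T k)%E].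
Proof.
move=> h1 h2; have tk : (t k < +oo)%E by apply: le_lt_trans h1 _; exact: ltry.
move: h1 h2; rewrite tS//; have := switching_ge0 k; have := switching_fin tk.
move: (fine _) => s ->; rewrite !lee_fin => s0 st.
by case: (T k) => [u| |]; rewrite ?ltry// -?EFinD ?lte_fin => // h; split=> //; lra.
Qed.
End Sequence.
End Switching.

(** * Stability from exponential decay, and stacked trajectories *)

Section Stability.
Variable R : realType.

(** [delta = eps / (1 + K)] works because [K < (1 + K)^2]; attraction follows from
    [exp (alpha u) >= 1 + alpha u]. *)
Lemma gas_of_decay p (sol : R -> (R -> 'cV[R]_p) -> Prop) (alpha : R) :
  0 < alpha -> (forall s, 0 <= s -> sol s (fun=> 0)) ->
  (forall s, 0 <= s -> exists2 K, 0 < K & forall z, sol s z -> forall u, s <= u ->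
     enorm (z u) ^+ 2 <= K * expR (- (alpha * u)) * enorm (z s) ^+ 2) ->
  globally_asymptotically_stable sol.
Proof.
move=> a0 sol0 decay; split=> // [s eps s0 eps0|s z s0 solz].
  have [K K0 Kz] := decay s s0.
  have d0 : 0 < eps / (1 + K) by rewrite divr_gt0// addr_gt0.
  exists (eps / (1 + K)) => // z solz zs u su.
  rewrite -(@ltr_pXn2r _ 2)// ?nnegrE ?enorm_ge0 ?(ltW eps0)//.
  have e1 : expR (- (alpha * u)) <= 1.
    by rewrite expR_le1 oppr_le0 mulr_ge0 ?(ltW a0)// (le_trans s0).
  apply: le_lt_trans (Kz z solz u su) _.
  have zs2 : enorm (z s) ^+ 2 <= (eps / (1 + K)) ^+ 2.
    by rewrite ler_pXn2r// ?nnegrE ?enorm_ge0 ?(ltW d0) ?(ltW zs).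
  apply: le_lt_trans (_ : K * (eps / (1 + K)) ^+ 2 < _).
    apply: ler_pM => //; rewrite ?sqr_ge0 ?mulr_ge0 ?expR_ge0 ?(ltW K0)//.
    by rewrite ger_pMr.
  have -> : K * (eps / (1 + K)) ^+ 2 = eps ^+ 2 * (K / (1 + K) ^+ 2).
    by field; rewrite gt_eqF// addr_gt0.
  rewrite gtr_pMr ?exprn_gt0// ltr_pdivrMr ?exprn_gt0 ?addr_gt0//; nra.
have [K K0 Kz] := decay s s0.
apply/cvgrPdist_lt => e e0; rewrite /=.
pose c := K * enorm (z s) ^+ 2.
have c0 : 0 <= c by rewrite mulr_ge0 ?sqr_ge0// ltW.
near=> u.
have su : s <= u by near: u; apply: nbhs_pinfty_ge; exact: num_real.
have uc : c / (e ^+ 2 * alpha) < u by near: u; apply: nbhs_pinfty_gt; exact: num_real.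
rewrite sub0r normrN ger0_norm ?enorm_ge0//.
rewrite -(@ltr_pXn2r _ 2)// ?nnegrE ?enorm_ge0 ?(ltW e0)//.
apply: le_lt_trans (Kz z solz u su) _.
rewrite mulrAC -/c expRN ltr_pdivrMr ?expR_gt0//.
have e20 : 0 < e ^+ 2 by rewrite exprn_gt0.
apply: lt_le_trans (_ : e ^+ 2 * (1 + alpha * u) <= _); last first.
  by rewrite ler_pM2l// expR_ge1Dx.
by move: uc; rewrite ltr_pdivrMr ?mulr_gt0//; lra.
Unshelve. all: by end_near. Qed.

Lemma enorm_col_mx p q (x : 'cV[R]_p) (y : 'cV[R]_q) :
  enorm (col_mx x y) ^+ 2 = dot x x + dot y y.
Proof. by rewrite enorm_sqr /dot tr_col_mx mul_row_col mxE. Qed.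

Lemma within_continuous_entry p (D : set R) (x : R -> 'cV[R]_p) i :
  {within D, continuous x} -> {within D, continuous (fun u => x u i 0)}.
Proof. by move=> xc u; apply: cvg_entry; exact: xc. Qed.

Lemma within_continuous_mxcol N (n : 'I_N -> nat) (D : set R)
    (x : forall i, R -> 'cV[R]_(n i)) k :
  (forall i, {within D, continuous (x i)}) ->
  {within D, continuous (fun u => (\mxcol_i x i u) k 0)}.
Proof.
move=> xc; rewrite (_ : (fun u => _) = fun u => x (tagnat.sig1 k) u (tagnat.sig2 k) 0).
  exact: within_continuous_entry.
by apply/funext => u; rewrite mxE.
Qed.

Lemma vderiv_mxcol N (n : 'I_N -> nat) (x : forall i, R -> 'cV[R]_(n i)) u
    (d : forall i, 'cV[R]_(n i)) :
  (forall i, vderiv (x i) u (d i)) -> vderiv (fun s => \mxcol_i x i s) u (\mxcol_i d i).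
Proof.
by move=> xd k; under eq_fun do rewrite mxE; rewrite mxE; exact: xd.
Qed.
End Stability.

(** * The distributed observer-based controller *)

Lemma solves_zero (R : realType) p (D E : set R) (f : R -> 'cV[R]_p) :
  (forall u, f u = 0) -> solves D E (fun=> 0) f.
Proof.
move=> f0; split; first by apply: continuous_subspaceT => u; exact: cvg_cst.
move=> u _ _; rewrite f0 /deriv_within subr0.
by under eq_fun do rewrite scaler0; exact: cvg_cst.
Qed.

Lemma deriv_within_vderiv (R : realType) p (s u : R) (x : R -> 'cV[R]_p) d :
  s < u -> deriv_within `[s, +oo[ x u d -> vderiv x u d.
Proof.
move=> su xd i; apply: deriv_within_entry xd.
by apply: filterS (lt_nbhsr su) => y /= sy; rewrite in_itv/= ltW.
Qed.

(** The control input acts identically on plant and observer and cancels in the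
    error dynamics. *)
Lemma subr_input_cancel (V : zmodType) (a b s p a' s' : V) :
  a + b + s + p - (a' + b + s') = (a - a') + (s - s') + p.
Proof.
rewrite addrAC; congr (_ + p).
by rewrite opprD addrACA opprD [a + b + _]addrACA subrr addr0.
Qed.

Theorem theorem3 (R : realType) (N : nat) (n m r : 'I_N -> nat)
  (* plant network *)
  (A : R -> forall i, 'M[R]_(n i))
  (B : R -> forall i, 'M[R]_(n i, m i))
  (C : R -> forall i, 'M[R]_(r i, n i))
  (H : R -> forall i j, 'M[R]_(n i, n j))
  (a b c h : R)
  (H_diag : forall s i, 0 <= s -> H s i i = 0)
  (controllable : forall i,
     completely_controllable (fun t => A t i) (fun t => B t i))
  (observable : forall i,
     completely_observable (fun t => A t i) (fun t => B t i) (fun t => C t i))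
  (A_C1 : C1_deriv_bounded (fun t => \mxdiag_i A t i) a)
  (B_C1 : C1_deriv_bounded (fun t => blockdiag (B t)) b)
  (C_C1 : C1_deriv_bounded (fun t => blockdiag (C t)) c)
  (H_C1 : C1_deriv_bounded (fun t => \mxblock_(i, j) H t i j) h)
  (* design constants *)
  (kappa mu : 'I_N -> R) (iota omega : 'I_N -> 'I_N -> R)
  (kappa_ge0 : forall i, 0 <= kappa i) (mu_ge0 : forall i, 0 <= mu i)
  (iota_ge0 : forall i j, 0 <= iota i j) (omega_ge0 : forall i j, 0 <= omega i j)
  (beta eps : 'I_N -> R) (gamma : R)
  (beta_gt0 : forall i, 0 < beta i) (eps_gt0 : forall i, 0 < eps i)
  (gamma_gt0 : 0 < gamma)
  (* design variables and switching times; t k = +oo means that step k is never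
     reached, the gains of the last finite step being kept forever *)
  (Z Ph : nat -> forall i, 'M[R]_(n i))
  (W : nat -> forall i, 'M[R]_(m i, n i))
  (Y : nat -> forall i j, 'M[R]_(m i, n j))
  (Wh : nat -> forall i, 'M[R]_(n i, r i))
  (Yh : nat -> forall i j, 'M[R]_(n i, r j))
  (t : nat -> \bar R) :
  let tk k : R := fine (t k) in
  let F k := ctrl_mx beta (A (tk k)) (B (tk k)) (H (tk k)) (Z k) (W k) (Y k) in
  let Fh k := obs_mx beta (A (tk k)) (C (tk k)) (H (tk k)) (Ph k) (Wh k) (Yh k) in
  let T k := dwell_time a b c h (F k) (Fh k) (Z k) (Ph k) (W k) (Y k) (Wh k) (Yh k) in
  let Zd k := \mxdiag_i Z k i in
  let Phd k := \mxdiag_i Ph k i in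
  let epsd := \mxdiag_i ((eps i)%:M : 'M[R]_(n i)) in
  (* structure and convex constraints *)
  (forall k, (t k < +oo)%E ->
    [/\ forall i, (Z k i)^T = Z k i,
        forall i, (Ph k i)^T = Ph k i,
        forall i, Y k i i = 0
      & forall i, Yh k i i = 0]) ->
  (forall k, (t k < +oo)%E ->
    [/\ psdmx (- (F k + (F k)^T + gamma%:M)),
        psdmx (- (Fh k + (Fh k)^T + gamma%:M)),
        psdmx (invmx epsd - Zd k),
        pdmx (Zd k)
      & psdmx (Phd k - epsd)]) ->
  (forall k, (t k < +oo)%E -> forall i j,
    [/\ 0 <= kappa i * lambda_min (Z k i) - sigma_max (W k i),
        0 <= iota i j * lambda_min (Z k j) - sigma_max (Y k i j),
        0 <= mu i * lambda_min (Ph k i) - sigma_max (Wh k i)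
      & 0 <= omega i j * lambda_min (Ph k i) - sigma_max (Yh k i j)]) ->
  (forall k, (t k.+1 < +oo)%E ->
    psdmx (Zd k.+1 - Zd k) /\ psdmx (Phd k - Phd k.+1)) ->
  (* switching times *)
  t 0%N = 0%E ->
  (forall k, (t k < +oo)%E -> t k.+1 = (t k + T k)%E) ->
  (forall k, t k = +oo%E -> t k.+1 = +oo%E) ->
  (exists2 Tmin : R, 0 < Tmin &
    forall k, (t k < +oo)%E -> (Tmin%:E <= T k)%E) ->
  (* gains *)
  forall (Kg : R -> forall i, 'M[R]_(m i, n i))
    (Lg : R -> forall i j, 'M[R]_(m i, n j))
    (Mg : R -> forall i, 'M[R]_(n i, r i))
    (Og : R -> forall i j, 'M[R]_(n i, r j)),
  (forall k (tau : R), (t k <= tau%:E)%E -> (tau%:E < t k.+1)%E -> forall i j,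
    [/\ Kg tau i = W k i *m invmx (Z k i),
        Lg tau i j = Y k i j *m invmx (Z k j),
        Mg tau i = invmx (Ph k i) *m Wh k i
      & Og tau i j = invmx (Ph k i) *m Yh k i j]) ->
  globally_asymptotically_stable
    (closed_loop A B C H Kg Lg Mg Og [set tau : R | exists k, t k = tau%:E])
  /\
  (forall k, (t k < +oo)%E -> forall i j,
    [/\ opnorm (W k i *m invmx (Z k i)) <= kappa i,
        opnorm (invmx (Ph k i) *m Wh k i) <= mu i,
        opnorm (Y k i j *m invmx (Z k j)) <= iota i j
      & opnorm (invmx (Ph k i) *m Yh k i j) <= omega i j]).
Proof.
move=> tk F Fh T Zd Phd epsd hstr hlmi hgain hmono t0 tS tSoo [Tmin Tmin0 TT] Kg Lg Mg Og gains.
have t_nd := switching_nd tS tSoo Tmin0 TT.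
have t_cover := switching_cover t0 tS tSoo Tmin0 TT.
have [delta delta0 epsge] := pos_lower_bound eps_gt0.
have [alpha alpha0 betage] := pos_lower_bound beta_gt0.
have Ph_ge k x : (t k < +oo)%E -> delta * dot x x <= dot x (Phd k *m x).
  move=> /hlmi[_ _ _ _ /(psdmx_dot x)].
  rewrite mulmxBl dotDr dotNr subr_ge0; apply: le_trans.
  exact: mxdiag_scalar_ge.
have Phd_sym k : (t k < +oo)%E -> (Phd k)^T = Phd k.
  by move=> /hstr[_ sP _ _]; rewrite tr_mxdiag; apply/eq_mxdiag => i; exact: sP.
have Phd_pd k : (t k < +oo)%E -> pdmx (Phd k).
  move=> tk1; split=> [|x x0]; first exact: Phd_sym.
  by rewrite mulmx_dot; apply: lt_le_trans (Ph_ge k x tk1); rewrite mulr_gt0// dot_gt0.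
have Z_pd k : (t k < +oo)%E -> pdmx (Zd k) by move=> /hlmi[].
have Zi_pd k i : (t k < +oo)%E -> pdmx (Z k i).
  by move=> tk1; apply: pdmx_block (Z_pd k tk1); have [sZ _ _ _] := hstr k tk1; exact: sZ.
have Pi_pd k i : (t k < +oo)%E -> pdmx (Ph k i).
  by move=> tk1; apply: pdmx_block (Phd_pd k tk1); have [_ sP _ _] := hstr k tk1; exact: sP.
have bounds : forall k, (t k < +oo)%E -> forall i j,
    [/\ opnorm (W k i *m invmx (Z k i)) <= kappa i,
        opnorm (invmx (Ph k i) *m Wh k i) <= mu i,
        opnorm (Y k i j *m invmx (Z k j)) <= iota i j
      & opnorm (invmx (Ph k i) *m Yh k i j) <= omega i j].
  move=> k tk1 i j; have [g1 g2 g3 g4] := hgain k tk1 i j.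
  have [[pZi pZj] pP] := (Zi_pd k i tk1, Zi_pd k j tk1, Pi_pd k i tk1).
  split; [exact: state_gain_bound | exact: injection_gain_bound
         | exact: state_gain_bound | exact: injection_gain_bound].
split=> //.
have a0 := C1_bound_ge0 A_C1; have b0 := C1_bound_ge0 B_C1.
have c0 := C1_bound_ge0 C_C1; have h0 := C1_bound_ge0 H_C1.
(* any bound on the form of invmx epsd serves: only a bound on Z that is uniform in k
   is needed *)
have [c1 c10 Z_le0] := form_bounded (invmx epsd).
have Z_le k x : (t k < +oo)%E -> dot x (Zd k *m x) <= c1 * dot x x.
  move=> /hlmi[_ _ /(psdmx_dot x) + _ _].
  rewrite mulmxBl dotDr dotNr subr_ge0 => h1; apply: le_trans h1 _.
  exact: le_trans (ler_norm _) (Z_le0 x).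
pose Wd k := blockdiag (W k) + \mxblock_(i, j) Y k i j.
pose Whd k := blockdiag (Wh k) + \mxblock_(i, j) Yh k i j.
pose D k := hadamard (beta_mx n beta) (Zd k).
pose Dh k := hadamard (beta_mx n beta) (Phd k).
have Z_unit k : (t k < +oo)%E -> Zd k \in unitmx by move=> /Z_pd; exact: pdmx_unit.
have P_unit k : (t k < +oo)%E -> Phd k \in unitmx by move=> /Phd_pd; exact: pdmx_unit.
have Zi_unit k i : (t k < +oo)%E -> Z k i \in unitmx by move=> /(Zi_pd k i); exact: pdmx_unit.
have Pi_unit k i : (t k < +oo)%E -> Ph k i \in unitmx by move=> /(Pi_pd k i); exact: pdmx_unit.
have pd_ge0 q (X : 'M[R]_q) x : pdmx X -> 0 <= dot x (X *m x).
  move=> pX; have [d d0 dX] := pdmx_coercive pX; apply: le_trans (dX x).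
  by rewrite mulr_ge0 ?dot_ge0// ltW.
have D_ge k w : (t k < +oo)%E -> alpha * dot w (Zd k *m w) <= dot w (D k *m w).
  by move=> tk1; apply: hadamard_form_ge => // i x; apply: pd_ge0; exact: Zi_pd.
have Dh_ge k w : (t k < +oo)%E -> alpha * dot w (Phd k *m w) <= dot w (Dh k *m w).
  by move=> tk1; apply: hadamard_form_ge => // i x; apply: pd_ge0; exact: Pi_pd.
pose cK := \sum_i (kappa i + \sum_j iota i j).
have gain_le k x : (t k < +oo)%E -> enorm (Wd k *m invmx (Zd k) *m x) <= cK * enorm x.
  move=> tk1; have [_ _ Y0 _] := hstr k tk1.
  apply: stacked_gain_bound => // [|i|i|i j]; [exact: Z_unit|exact: Zi_unit| |].
    by have [] := bounds k tk1 i i.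
  by have [] := bounds k tk1 i j.
(* nonnegative margins, as the quotients in the dwell time require *)
have lmax_le0 (X : 'M[R]_(\sum_i n i)) : psdmx (- (X + X^T + gamma%:M)) ->
    lambda_max (X + X^T) <= 0.
  move=> pX; apply: lambda_max_le => // [|x]; first by rewrite linearD/= trmxK addrC.
  have := psdmx_dot x pX; rewrite mulNmx mulmxDl mul_scalar_mx dotNr dotDr dotZr mul0r.
  by have := mulr_ge0 (ltW gamma_gt0) (dot_ge0 x); lra.
have dwell k (tau : R) : (t k <= tau%:E)%E -> (tau%:E < t k.+1)%E ->
    [/\ 0 <= tk k, tk k <= tau,
      lambda_max (F k + (F k)^T) + 2 * (tau - tk k) *
        ((a + h) * opnorm (Zd k) + b * opnorm (Wd k)) <= 0 &
      lambda_max (Fh k + (Fh k)^T) + 2 * (tau - tk k) *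
        ((a + h) * opnorm (Phd k) + c * opnorm (Whd k)) <= 0].
  move=> h1 h2; have tk1 : (t k < +oo)%E by apply: le_lt_trans h1 _; exact: ltry.
  have [s0 st el] := switching_elapsed t0 tS tSoo Tmin0 TT h1 h2.
  have [pF pFh _ _ _] := hlmi k tk1.
  have l1 := lmax_le0 _ pF; have l2 := lmax_le0 _ pFh.
  have [||||e1 e2] := half_mine_quotient _ _ _ _ el.
  - rewrite oppr_ge0; exact: l1.
  - rewrite oppr_ge0; exact: l2.
  - by rewrite addr_ge0 ?mulr_ge0 ?opnorm_ge0 ?addr_ge0.
  - by rewrite addr_ge0 ?mulr_ge0 ?opnorm_ge0 ?addr_ge0.
  split; [exact: s0 | exact: st | |]; rewrite -lerBrDl sub0r; [exact: e1 | exact: e2].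
pose AA u := \mxdiag_i A u i; pose HH u := \mxblock_(i, j) H u i j.
pose BB u := blockdiag (B u); pose CC u := blockdiag (C u).
have lmi k (tau : R) w : (t k <= tau%:E)%E -> (tau%:E < t k.+1)%E ->
    dot w (((AA tau + HH tau) *m Zd k + BB tau *m Wd k + D k) *m w) <= 0.
  move=> h1 h2; have [s0 st l1 _] := dwell k tau h1 h2.
  exact: (ctrl_lmi w A_C1 B_C1 H_C1 s0 st l1).
have lmih k (tau : R) w : (t k <= tau%:E)%E -> (tau%:E < t k.+1)%E ->
    dot w ((Phd k *m (AA tau + HH tau) + Whd k *m CC tau + Dh k) *m w) <= 0.
  move=> h1 h2; have [s0 st _ l1] := dwell k tau h1 h2.
  exact: (obs_lmi w A_C1 C_C1 H_C1 s0 st l1).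
have decay := stacked_decay alpha0 c10 delta0 B_C1 t0 t_nd t_cover Z_pd Z_le
  Phd_sym Ph_ge hmono gain_le D_ge Dh_ge lmi lmih.
apply: (gas_of_decay alpha0) => [s s0|s s0].
  exists (fun i _ => 0), (fun i _ => 0), (fun i _ => 0), (fun i _ => 0); split.
  - move=> u _; rewrite -[LHS]col_mx0.
    by congr (col_mx _ _); apply/matrixP => i j; rewrite !mxE ?subr0.
  - by move=> i u _; rewrite mulmx0.
  - by move=> i u _; rewrite mulmx0 add0r big1// => j _; rewrite mulmx0.
  - move=> i; apply: solves_zero => u.
    by rewrite !mulmx0 !add0r big1// => j _; rewrite mulmx0.
  - move=> i; apply: solves_zero => u.
    rewrite !(mulmx0, add0r, subr0, addr0) big1 ?add0r; last by move=> j _; rewrite mulmx0.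
    by rewrite big1// => j _; rewrite !(mulmx0, subr0).
have [K K0 Kz] := decay s s0; exists K => // z [x [xh [u [y [zE yE uE xs xhs]]]]] v sv.
rewrite !zE// !enorm_col_mx.
apply: (Kz (fun v => \mxcol_i x i v) (fun v => \mxcol_i (xh i v - x i v))) => // [i|i|k w sw tw wt].
- by apply: within_continuous_mxcol => j; exact: (xs j).1.
- apply: (@within_continuous_mxcol _ _ _ _ (fun i v => xh i v - x i v)) => j w.
  by apply: cvgB; [exact: (xhs j).1 | exact: (xs j).1].
have tk1 : (t k < +oo)%E by apply: lt_trans tw _; exact: ltry.
(* inside a step no switching occurs, so the trajectory is differentiable *)
have nE : ~ [set tau : R | exists k, t k = tau%:E] w.
  exact: switching_apart tS tSoo Tmin0 TT _ _ tw wt.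
have [_ _ Y0 Yh0] := hstr k tk1.
have w0 : 0 <= w by apply: le_trans s0 (ltW sw).
have gw := gains k w (ltW tw) wt.
have sw' : `[s, +oo[%classic w by rewrite /= in_itv/= ltW.
have dxi i := deriv_within_vderiv sw ((xs i).2 w sw' nE).
have dxhi i := deriv_within_vderiv sw ((xhs i).2 w sw' nE).
have uW : \mxcol_i u i w = Wd k *m (invmx (Zd k) *m \mxcol_i xh i w).
  rewrite mul_invmx_mxdiag ?Z_unit//; last by move=> i; exact: Zi_unit.
  rewrite mul_block_mxcol//; apply/eq_mxcol => i; rewrite uE ?ltW//.
  have [-> _ _ _] := gw i i; rewrite mulmxA; congr (_ + _).
  by apply: eq_bigr => j _; have [_ -> _ _] := gw i j; rewrite mulmxA.
split.
  have -> : \mxcol_i x i w + \mxcol_i (xh i w - x i w) = \mxcol_i xh i w.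
    by rewrite -mxcolD; apply/eq_mxcol => i; rewrite addrC subrK.
  rewrite -uW; have := vderiv_mxcol dxi; congr vderiv.
  rewrite [_ *m \mxcol_i x i w](mul_block_mxcol _ _ (fun i => H_diag w i w0)).
  rewrite mul_blockdiag_mxcol -mxcolD; apply/eq_mxcol => i.
  by rewrite addrAC.
have := vderiv_mxcol (fun i => vderivB (dxhi i) (dxi i)); congr vderiv.
rewrite [_ *m \mxcol_i (xh i w - x i w)](mul_block_mxcol _ _ (fun i => H_diag w i w0)).
rewrite mul_blockdiag_mxcol mul_block_mxcol// mul_invmx_mxdiag ?P_unit//; last first.
  by move=> i; exact: Pi_unit.
rewrite -mxcolD; apply/eq_mxcol => i.
have yi j : C w j *m xh j w - y j w = C w j *m (xh j w - x j w).
  by rewrite yE ?ltW// mulmxBr.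
rewrite -[_ + _ + \sum_(j | j != i) Og w i j *m _]addrA subr_input_cancel.
congr (_ + _ + _); first by rewrite mulmxBr.
  by rewrite -sumrB; apply: eq_bigr => j _; rewrite mulmxBr.
have [_ _ -> _] := gw i i; rewrite yi [RHS]mulmxDr !mulmxA; congr (_ + _).
rewrite mulmx_sumr; apply: eq_bigr => j _.
by have [_ _ _ ->] := gw i j; rewrite yi !mulmxA.
Qed.
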